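(* Let $\tau\in\mathbb{C}$ with $\mathrm{Im}(\tau)>0$ and fix $q=\exp(2\pi\sqrt{-1}\,\tau)$. Then $$w\ \longmapsto\ \Big(\ (2\pi\sqrt{-1})^2\,\mathcal{W}(w,q)-\frac{\pi^2}{3}E_2(\tau)\ :\ (2\pi\sqrt{-1})^3\, w\frac{\partial}{\partial w}\mathcal{W}(w,q)\ :\ 1\ \Big)$$ gives a morphism $\Phi:\mathbb{C}_w^\times\to E_\tau\subset\mathbb{P}^2$ which, as the right vertical arrow, makes the following diagram commutative: $$\begin{array}{ccc} \mathbb{C}_{\mathrm{Log}z} & \xrightarrow{\ \mathrm{Log}z\,\mapsto\, w=\exp(\tau\,\mathrm{Log}z)\ } & \mathbb{C}_w^\times\\ {\scriptstyle \exp}\downarrow\ \ & & \ \ \downarrow{\scriptstyle \Phi}\\ \mathbb{C}_z^\times & \xrightarrow{\ \bmod^\times \exp(\Gamma_w)\ } & E_\tau \end{array}$$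
   Context: Notation: $\mathbb{C}^\times=\mathbb{C}\setminus\{0\}$; a subscript on $\mathbb{C}$ or $\mathbb{C}^\times$ names the coordinate used on it. $\mathbb{C}_{\mathrm{Log}z}$ is the complex plane with coordinate $\mathrm{Log}z$, viewed as the universal covering of $\mathbb{C}_z^\times$ via $\exp(\mathrm{Log}z)=z$. Two groups act on it by translations: $\Gamma_g=2\pi\sqrt{-1}\,\mathbb{Z}$, whose quotient map is $\exp:\mathbb{C}_{\mathrm{Log}z}\to\mathbb{C}_z^\times$, and $\Gamma_w=\frac{2\pi\sqrt{-1}}{\tau}\mathbb{Z}$, whose quotient map is $\mathrm{Log}z\mapsto w=\exp(\tau\,\mathrm{Log}z)\in\mathbb{C}_w^\times$. One has $\Gamma_g+\Gamma_w=\frac{2\pi\sqrt{-1}}{\tau}(\mathbb{Z}+\mathbb{Z}\tau)$. $E_\tau$ is the quotient of $\mathbb{C}_z^\times$ by multiplication by the group $\exp(\Gamma_w)=\{\exp(\frac{2\pi\sqrt{-1}}{\tau}n): n\in\mathbb{Z}\}$; equivalently $E_\tau=\mathbb{C}_{\mathrm{Log}z}/(\Gamma_g+\Gamma_w)$. The lower horizontal arrow is this quotient map. With the coordinate $u=\frac{\tau}{2\pi\sqrt{-1}}\mathrm{Log}z$ (so that $w=\exp(2\pi\sqrt{-1}\,u)$), $E_\tau=\mathbb{C}_u/(\mathbb{Z}+\mathbb{Z}\tau)$ is realized as a plane curve in $\mathbb{P}^2$ by $u\bmod(\mathbb{Z}+\mathbb{Z}\tau)\mapsto(\wp(u,\tau):\wp'(u,\tau):1)$,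 where $\wp(u,\tau)$ is the Weierstrass $\wp$-function of the lattice $\mathbb{Z}+\mathbb{Z}\tau$ and $\wp'=\partial\wp/\partial u$ (lattice points are sent to $(0:1:0)$). As usual, a point of $\mathbb{P}^2$ given by meromorphic functions is defined at their poles by clearing denominators (holomorphic extension). $\mathcal{W}(w,q)=\sum_{m\in\mathbb{Z}}\frac{wq^m}{(1-wq^m)^2}$, a meromorphic function of $(w,q)$ with $w\in\mathbb{C}^\times$, $0<|q|<1$. $E_2(\tau)=\frac{3}{\pi^2}\sum_{m\in\mathbb{Z}}\Big(\sum_{n\in\mathbb{Z}}{}^{'}\frac{1}{(m\tau+n)^2}\Big)$ is the Eisenstein series of weight 2, where the inner sum over $n$ is carried out first and $'$ means that $n=0$ is omitted if $m=0$. *)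

(* Defs.v *)
From Stdlib Require Import Reals Lra ZArith List.
From Stdlib Require Import ClassicalEpsilon FunctionalExtensionality
  PropExtensionality ProofIrrelevance.
From Coquelicot Require Import Coquelicot.

Open Scope C_scope.

Definition quot {T : Type} (R : T -> T -> Prop) : Type :=
  {A : T -> Prop | exists x, A = R x}.

Definition class {T : Type} (R : T -> T -> Prop) (x : T) : quot R :=
  exist _ (R x) (ex_intro _ x eq_refl).

Lemma class_eq {T : Type} (R : T -> T -> Prop) (x y : T) :
  (forall a, R a a) -> (forall a b, R a b -> R b a) ->
  (forall a b c, R a b -> R b c -> R a c) ->
  class R x = class R y <-> R x y.
Proof.
intros Hr Hs Ht; split; intros H.
- apply (f_equal (@proj1_sig _ _)) in H; simpl in H.
  rewrite H; apply Hr.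
- apply subset_eq_compat, functional_extensionality; intros z.
  apply propositional_extensionality; split; intros Hz; eauto.
Qed.

Lemma class_surj {T : Type} (R : T -> T -> Prop) (e : quot R) :
  exists x, class R x = e.
Proof.
destruct e as [A [x ->]]; exists x; reflexivity.
Qed.

Definition Cexp (z : C) : C := RtoC (exp (Re z)) * (cos (Im z), sin (Im z)).

Lemma Cexp_neq_0 (z : C) : Cexp z <> 0.
Proof.
apply Cmult_neq_0.
- intros H; apply RtoC_inj in H; pose proof (exp_pos (Re z)); lra.
- intros H; injection H as Hc Hs.
  pose proof (sin2_cos2 (Im z)) as H1.
  unfold Rsqr in H1; rewrite Hc, Hs in H1; lra.
Qed.

Definition Cpowz (q : C) (m : Z) : C :=
  match m with
  | Z0 => 1
  | Zpos p => q ^ Pos.to_nat p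
  | Zneg p => / q ^ Pos.to_nat p
  end.

Definition ZtoC (n : Z) : C := RtoC (IZR n).

Definition two_pi_i : C := 2 * PI * Ci.

(** Unconditional summability: convergence along finite subsets of [I]. *)
Definition is_sum_over {I : Type} (f : I -> C) (s : C) : Prop :=
  forall eps : posreal, exists F : list I,
    forall G : list I, NoDup G -> incl F G ->
      (Cmod (fold_right Cplus 0 (map f G) - s) < eps)%R.

(** The sum when it exists; an unspecified complex number otherwise. *)
Definition sum_over {I : Type} (f : I -> C) : C := iota (T := C_CompleteNormedModule) (is_sum_over f).

Definition lattice_pt (tau : C) (p : Z * Z) : C :=
  ZtoC (fst p) * tau + ZtoC (snd p).

Definition is_lattice_pt (tau u : C) : Prop :=
  exists p : Z * Z, u = lattice_pt tau p.

Definition wp (tau u : C) : C :=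
  1 / u ^ 2 +
  sum_over (fun p : Z * Z =>
    match p with
    | (0%Z, 0%Z) => 0
    | _ => 1 / (u - lattice_pt tau p) ^ 2 - 1 / lattice_pt tau p ^ 2
    end).

Definition wp' (tau u : C) : C := C_derive (wp tau) u.

Definition calW (w q : C) : C :=
  sum_over (fun m : Z => w * Cpowz q m / (1 - w * Cpowz q m) ^ 2).

Definition is_calW_pole (w q : C) : Prop :=
  exists m : Z, w * Cpowz q m = 1.

(** The inner sum (over [n]) is taken first; the iterated sum is not the sum
    over [Z * Z], which does not converge unconditionally. *)
Definition E2 (tau : C) : C :=
  3 / PI ^ 2 *
  sum_over (fun m : Z => sum_over (fun n : Z =>
    match m, n with
    | 0%Z, 0%Z => 0
    | _, _ => 1 / (ZtoC m * tau + ZtoC n) ^ 2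
    end)).

Definition C3 : Type := (C * C * C)%type.

Definition vec_nz : Type := {v : C3 | v <> (RtoC 0, RtoC 0, RtoC 0)}.

Definition scale3 (c : C) (v : C3) : C3 :=
  let '(x, y, z) := v in (c * x, c * y, c * z).

Definition proportional (v v' : vec_nz) : Prop :=
  exists c : C, c <> 0 /\ proj1_sig v' = scale3 c (proj1_sig v).

Definition P2 : Type := quot proportional.

Definition has_coords (P : P2) (x y z : C) : Prop :=
  exists H : (x, y, z) <> (RtoC 0, RtoC 0, RtoC 0),
    P = class proportional (exist _ (x, y, z) H).

Lemma affine_nz (x y : C) : (x, y, RtoC 1) <> (RtoC 0, RtoC 0, RtoC 0).
Proof. intros H; injection H as _ _ H1; lra. Qed.

Lemma infinity_nz : (RtoC 0, RtoC 1, RtoC 0) <> (RtoC 0, RtoC 0, RtoC 0).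
Proof. intros H; injection H as H1; lra. Qed.

Definition affine_pt (x y : C) : P2 :=
  class proportional (exist _ (x, y, RtoC 1) (affine_nz x y)).

Definition infinity_pt : P2 :=
  class proportional (exist _ (RtoC 0, RtoC 1, RtoC 0) infinity_nz).

Definition Cstar : Type := {z : C | z <> 0}.

Definition exp_star (x : C) : Cstar := exist _ (Cexp x) (Cexp_neq_0 x).

(** Holomorphy of a map into [P2]: near every point it has homogeneous
    coordinates that are holomorphic and have no common zero (the latter is
    built into [has_coords]). *)
Definition holomorphic_P2 (Psi : Cstar -> P2) : Prop :=
  forall w0 : Cstar, exists h0 h1 h2 : C -> C,
    locally (proj1_sig w0) (fun w : C =>
      ex_derive h0 w /\ ex_derive h1 w /\ ex_derive h2 w /\
      forall Hw : w <> 0,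
        has_coords (Psi (exist _ w Hw)) (h0 w) (h1 w) (h2 w)).

(** Congruence of [z] and [z'] modulo multiplication by [exp(Gamma_w)],
    where [Gamma_w = (2 pi i / tau) Z]. *)
Definition mod_exp_Gamma_w (tau : C) (z z' : Cstar) : Prop :=
  exists n : Z,
    proj1_sig z' = Cexp (two_pi_i / tau * ZtoC n) * proj1_sig z.

Definition E (tau : C) : Type := quot (mod_exp_Gamma_w tau).

Definition E_proj (tau : C) (z : Cstar) : E tau :=
  class (mod_exp_Gamma_w tau) z.

Definition wp_pt (tau u : C) : P2 :=
  if excluded_middle_informative (is_lattice_pt tau u)
  then infinity_pt
  else affine_pt (wp tau u) (wp' tau u).

(** The realization of [E tau] as a plane curve: the class of [exp x] is sent
    to [wp_pt tau u] with [u = tau / (2 pi i) * x].  A representative [x] is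
    chosen; the result does not depend on it, since [wp] is periodic. *)
Definition E_Log (tau : C) (e : E tau) : C :=
  epsilon (inhabits (RtoC 0)) (fun x : C => E_proj tau (exp_star x) = e).

Definition E_embed (tau : C) (e : E tau) : P2 :=
  wp_pt tau (tau / two_pi_i * E_Log tau e).

(* Main.v *)
Require Import Defs.
From Stdlib Require Import Reals Lra Lia ZArith List Permutation ClassicalEpsilon.
From Coquelicot Require Import Coquelicot.
Open Scope C_scope.

(** The curve coordinate [u] and the multiplicative coordinate [w] are related by
    [w = exp (2 pi i u)], so the theorem amounts to the identity
    [wp tau u = (2 pi i)^2 calW w q - (PI^2 / 3) E2 tau] ([wp_eq_calW]), to its
    derivative in [u], and to a local analysis at the poles.

    The identity comes from summing the double series of [wp] row by row.  The
    row of index [m] of [1 / (u - m tau - n)^2] is the partial fraction series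
    of [(PI / sin (PI v))^2] at [v = u - m tau], hence equals
    [(2 pi i)^2 X / (1 - X)^2] with [X = w q^(-m)] ([Herglotz]); the rows of
    [1 / (m tau + n)^2] give the inner sums of [E2].  The terms of the [wp]
    series are of cubic decay ([wp_term_bounded]), so unconditional summation
    and Fubini ([is_sum_over_Fubini]) turn the double sum into the iterated one,
    and the difference [calW - wp] then shows that the outer sum of [E2]
    converges, to the value required.

    Holomorphy is proved on the side of [calW], where convergence is geometric.
    With the term of one index [m0] removed, the series and the series of its
    logarithmic derivatives are termwise differentiable on a neighbourhood of
    any [w0] that is not a pole of another term
    ([is_C_derive_punctured_koebe], [ex_C_derive_punctured_theta_koebe]), and
    the remaining term has a pole of order at most 3 in [1 - w q^m0].
    Multiplying the three homogeneous coordinates by [(1 - w q^m0)^3] clears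
    it; where [w q^m0 = 1] they become [(0 : 2 (2 pi i)^3 : 0)], the point at
    infinity ([w_to_E_holomorphic]).

    The map itself sends [w] to the class of [exp (L / tau)] for any logarithm
    [L] of [w].  Evaluating [E_embed] there involves another choice of
    logarithm, and leads to a point [u] with [exp (2 pi i u) = w q^k] for some
    integer [k] ([E_embed_w_to_E]); this is harmless because [calW] is
    invariant under [w -> w q] ([calW_shift]).  The square commutes because two
    logarithms of [exp (tau x)] differ by a multiple of [2 pi i], which
    division by [tau] moves into [Gamma_w]. *)

(** * Unconditional sums *)

Definition lsum {I : Type} (f : I -> C) (G : list I) : C :=
  fold_right Cplus 0 (map f G).

Definition rsum {I : Type} (a : I -> R) (G : list I) : R :=
  fold_right Rplus 0%R (map a G).

Lemma lsum_app {I : Type} (f : I -> C) (G H : list I) :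
  lsum f (G ++ H) = lsum f G + lsum f H.
Proof.
unfold lsum; induction G as [|x G IH]; simpl; [ring|rewrite IH; ring].
Qed.

Lemma rsum_app {I : Type} (a : I -> R) (G H : list I) :
  rsum a (G ++ H) = (rsum a G + rsum a H)%R.
Proof.
unfold rsum; induction G as [|x G IH]; simpl; [ring|rewrite IH; ring].
Qed.

Lemma lsum_perm {I : Type} (f : I -> C) (G H : list I) :
  Permutation G H -> lsum f G = lsum f H.
Proof.
unfold lsum; induction 1; simpl; [reflexivity|congruence|ring|congruence].
Qed.

Lemma lsum_map {I J : Type} (h : I -> J) (f : J -> C) (G : list I) :
  lsum f (map h G) = lsum (fun i => f (h i)) G.
Proof. unfold lsum; rewrite map_map; reflexivity. Qed.

Lemma rsum_map {I J : Type} (h : I -> J) (a : J -> R) (G : list I) :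
  rsum a (map h G) = rsum (fun i => a (h i)) G.
Proof. unfold rsum; rewrite map_map; reflexivity. Qed.

Lemma lsum_plus {I : Type} (f g : I -> C) (G : list I) :
  lsum (fun i => f i + g i) G = lsum f G + lsum g G.
Proof.
unfold lsum; induction G as [|x G IH]; simpl; [ring|rewrite IH; ring].
Qed.

Lemma lsum_scal {I : Type} (c : C) (f : I -> C) (G : list I) :
  lsum (fun i => c * f i) G = c * lsum f G.
Proof.
unfold lsum; induction G as [|x G IH]; simpl; [ring|rewrite IH; ring].
Qed.

Lemma rsum_scal {I : Type} (c : R) (a : I -> R) (G : list I) :
  rsum (fun i => c * a i)%R G = (c * rsum a G)%R.
Proof.
unfold rsum; induction G as [|x G IH]; simpl; [ring|rewrite IH; ring].
Qed.

Lemma rsum_le {I : Type} (a b : I -> R) (G : list I) :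
  (forall i, In i G -> a i <= b i)%R -> (rsum a G <= rsum b G)%R.
Proof.
unfold rsum; induction G as [|x G IH]; simpl; intros H; [lra|].
apply Rplus_le_compat; auto.
Qed.

Lemma rsum_ge_0 {I : Type} (a : I -> R) (G : list I) :
  (forall i, 0 <= a i)%R -> (0 <= rsum a G)%R.
Proof.
intros H; unfold rsum; induction G as [|x G IH]; simpl; [lra|].
specialize (H x); lra.
Qed.

Lemma Cmod_lsum_le {I : Type} (f : I -> C) (G : list I) :
  (Cmod (lsum f G) <= rsum (fun i => Cmod (f i)) G)%R.
Proof.
unfold lsum, rsum; induction G as [|x G IH]; simpl; [rewrite Cmod_0; lra|].
eapply Rle_trans; [apply Cmod_triangle|]; lra.
Qed.

(** Partial sums over [H] and over a subset [G] differ by the partial sum over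
    the complement; this is how every tail below is estimated. *)
Lemma NoDup_incl_split {I : Type} (G H : list I) :
  NoDup G -> incl G H -> exists H', Permutation H (G ++ H').
Proof.
revert H; induction G as [|x G IH]; intros H Hd Hi.
- exists H; apply Permutation_refl.
- inversion Hd as [|? ? Hx Hd']; subst.
  destruct (in_split x H (Hi x (or_introl eq_refl))) as [H1 [H2 ->]].
  destruct (IH (H1 ++ H2) Hd') as [H' HP].
  { intros y Hy.
    assert (Hy' := Hi y (or_intror Hy)).
    apply in_app_or in Hy'; apply in_or_app.
    destruct Hy' as [?|[->|?]]; auto; contradiction. }
  exists H'; apply Permutation_trans with (x :: H1 ++ H2).
  + apply Permutation_sym, Permutation_middle.
  + simpl; apply perm_skip, HP.
Qed.

Lemma rsum_perm {I : Type} (a : I -> R) (G H : list I) :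
  Permutation G H -> rsum a G = rsum a H.
Proof.
unfold rsum; induction 1; simpl; [reflexivity|congruence|ring|congruence].
Qed.

Lemma rsum_incl {I : Type} (a : I -> R) (G H : list I) :
  (forall i, 0 <= a i)%R -> NoDup G -> incl G H -> (rsum a G <= rsum a H)%R.
Proof.
intros Ha Hd Hi; destruct (NoDup_incl_split G H Hd Hi) as [H' HP].
rewrite (rsum_perm _ _ _ HP), rsum_app.
assert (H0 := rsum_ge_0 a H' Ha); lra.
Qed.

Lemma eq_dec_classic {I : Type} (x y : I) : {x = y} + {x <> y}.
Proof. apply excluded_middle_informative. Qed.

Definition list_union {I : Type} (F G : list I) : list I :=
  nodup eq_dec_classic (F ++ G).

Lemma list_union_NoDup {I : Type} (F G : list I) : NoDup (list_union F G).
Proof. apply NoDup_nodup. Qed.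

Lemma incl_list_union_l {I : Type} (F G : list I) : incl F (list_union F G).
Proof. intros x Hx; apply nodup_In, in_or_app; auto. Qed.

Lemma incl_list_union_r {I : Type} (F G : list I) : incl G (list_union F G).
Proof. intros x Hx; apply nodup_In, in_or_app; auto. Qed.

(** The filter of large finite subsets of [I], along which [is_sum_over]
    is a limit of partial sums. *)
Definition finite_subsets {I : Type} (P : list I -> Prop) : Prop :=
  exists F : list I, forall G, NoDup G -> incl F G -> P G.

Global Instance finite_subsets_proper {I : Type} :
  ProperFilter (@finite_subsets I).
Proof.
constructor; [|constructor].
- intros P [F HF]; exists (list_union F nil).
  apply HF; [apply list_union_NoDup|apply incl_list_union_l].
- exists nil; auto.
- intros P Q [F HF] [F' HF']; exists (F ++ F'); intros G Hd Hi; split.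
  + apply HF; auto; intros x Hx; apply Hi, in_or_app; auto.
  + apply HF'; auto; intros x Hx; apply Hi, in_or_app; auto.
- intros P Q HPQ [F HF]; exists F; auto.
Qed.

(** The neighbourhoods of [C] are those of the product [R * R]; the discs of
    [Cmod] form another base. *)
Lemma locally_C_Cmod (z : C) (P : C -> Prop) :
  locally z P <-> exists d : posreal, forall w, (Cmod (w - z) < d)%R -> P w.
Proof.
split; intros [d Hd].
- exists d; intros w Hw; apply Hd.
  apply (C_NormedModule_mixin_compat1 z w d), Hw.
- assert (Hs : (0 < sqrt 2)%R) by (apply sqrt_lt_R0; lra).
  assert (He : (0 < d / sqrt 2)%R)
    by (apply Rdiv_lt_0_compat; [apply cond_pos|exact Hs]).
  exists (mkposreal _ He); intros w Hw; apply Hd.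
  assert (H := C_NormedModule_mixin_compat2 z w (mkposreal _ He) Hw).
  simpl in H; replace (sqrt 2 * (d / sqrt 2))%R with (pos d) in H
    by (field; lra); exact H.
Qed.

Lemma is_sum_over_filterlim {I : Type} (f : I -> C) (s : C) :
  is_sum_over f s <-> filterlim (lsum f) finite_subsets (locally s).
Proof.
split.
- intros H P HP; apply locally_C_Cmod in HP; destruct HP as [d Hd].
  destruct (H d) as [F HF]; exists F; intros G Hn Hi; apply Hd, HF; auto.
- intros H eps.
  destruct (H (fun z => Cmod (z - s) < eps)%R) as [F HF].
  { apply locally_C_Cmod; exists eps; auto. }
  exists F; exact HF.
Qed.

Lemma is_sum_over_unique {I : Type} (f : I -> C) (s s' : C) :
  is_sum_over f s -> is_sum_over f s' -> s = s'.
Proof.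
intros H H'; apply is_sum_over_filterlim in H, H'.
exact (filterlim_locally_unique (V := C_NormedModule) (lsum f) s s' H H').
Qed.

Lemma sum_over_eq {I : Type} (f : I -> C) (s : C) :
  is_sum_over f s -> sum_over f = s.
Proof.
intros H; unfold sum_over; apply (iota_unique (V := C_CompleteNormedModule)).
- intros y Hy; exact (is_sum_over_unique f y s Hy H).
- exact H.
Qed.

Lemma is_sum_over_ext {I : Type} (f g : I -> C) (s : C) :
  (forall i, f i = g i) -> is_sum_over f s -> is_sum_over g s.
Proof.
intros Hfg H eps; destruct (H eps) as [F HF]; exists F; intros G Hd Hi.
rewrite <- (map_ext f g Hfg); auto.
Qed.

Lemma is_sum_over_plus {I : Type} (f g : I -> C) (s t : C) :
  is_sum_over f s -> is_sum_over g t ->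
  is_sum_over (fun i => f i + g i) (s + t).
Proof.
rewrite !is_sum_over_filterlim; intros Hf Hg.
apply filterlim_ext with (fun G => lsum f G + lsum g G).
- intros G; symmetry; apply lsum_plus.
- eapply filterlim_comp_2; [exact Hf|exact Hg|exact (filterlim_plus (V := C_NormedModule) s t)].
Qed.

Lemma is_sum_over_scal {I : Type} (c : C) (f : I -> C) (s : C) :
  is_sum_over f s -> is_sum_over (fun i => c * f i) (c * s).
Proof.
rewrite !is_sum_over_filterlim; intros Hf.
apply filterlim_ext with (fun G => c * lsum f G).
- intros G; symmetry; apply lsum_scal.
- eapply filterlim_comp; [exact Hf|].
  exact (filterlim_scal_r (V := C_NormedModule) c s).
Qed.

Lemma is_sum_over_minus {I : Type} (f g : I -> C) (s t : C) :
  is_sum_over f s -> is_sum_over g t ->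
  is_sum_over (fun i => f i - g i) (s - t).
Proof.
intros Hf Hg; replace (s - t) with (s + (-(1)) * t) by ring.
apply is_sum_over_ext with (fun i => f i + (-(1)) * g i).
- intros i; ring.
- apply is_sum_over_plus; [|apply is_sum_over_scal]; assumption.
Qed.

Lemma is_sum_over_reindex {I J : Type} (h : I -> J) (k : J -> I)
    (f : J -> C) (s : C) :
  (forall i, k (h i) = i) -> (forall j, h (k j) = j) ->
  is_sum_over f s -> is_sum_over (fun i => f (h i)) s.
Proof.
intros Hkh Hhk H eps; destruct (H eps) as [F HF].
exists (map k F); intros G Hd Hi.
change (Cmod (lsum (fun i => f (h i)) G - s) < eps)%R.
rewrite <- lsum_map; apply HF.
- apply FinFun.Injective_map_NoDup; auto.
  intros x y Hxy; rewrite <- (Hkh x), <- (Hkh y), Hxy; reflexivity.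
- intros j Hj; rewrite <- (Hhk j); apply in_map, Hi, in_map, Hj.
Qed.

Lemma lsum_zero {I : Type} (f : I -> C) (G : list I) :
  (forall i, In i G -> f i = 0) -> lsum f G = 0.
Proof.
unfold lsum; induction G as [|x G IH]; simpl; intros H; [reflexivity|].
rewrite H, IH; auto; ring.
Qed.

Lemma is_sum_over_finite {I : Type} (f : I -> C) (F : list I) :
  NoDup F -> (forall i, ~ In i F -> f i = 0) -> is_sum_over f (lsum f F).
Proof.
intros HF H eps; exists F; intros G Hd Hi.
change (Cmod (lsum f G - lsum f F) < eps)%R.
destruct (NoDup_incl_split F G HF Hi) as [H' HP].
rewrite (lsum_perm f _ _ HP), lsum_app, (lsum_zero f H').
- replace (_ - _) with (RtoC 0) by ring; rewrite Cmod_0; apply cond_pos.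
- intros i Hi'; apply H; intros HiF.
  apply (Permutation_NoDup HP) in Hd.
  apply in_split in Hi'; destruct Hi' as [A [B ->]].
  rewrite app_assoc in Hd; apply NoDup_remove_2 in Hd; apply Hd.
  apply in_or_app; left; apply in_or_app; auto.
Qed.

Lemma is_sum_over_single {I : Type} (f : I -> C) (i0 : I) :
  (forall i, i <> i0 -> f i = 0) -> is_sum_over f (f i0).
Proof.
intros H; replace (f i0) with (lsum f (i0 :: nil)) by (unfold lsum; simpl; ring).
apply is_sum_over_finite.
- repeat constructor; intros [].
- intros i Hi; apply H; intros ->; apply Hi; left; reflexivity.
Qed.

(** Absolute summability with an explicit bound: the bound passes to the sum of
    the family, which makes termwise error estimates uniform. *)
Definition bounded_sums {I : Type} (f : I -> C) (B : R) : Prop :=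
  forall G, NoDup G -> (rsum (fun i => Cmod (f i)) G <= B)%R.

(** Once a finite set nearly attains the supremum of the sums of moduli, any
    larger finite set adds little: the net of partial sums is Cauchy. *)
Lemma bounded_sums_is_sum {I : Type} (f : I -> C) (B : R) :
  bounded_sums f B -> exists s, is_sum_over f s.
Proof.
intros HB.
set (a := fun i => Cmod (f i)).
assert (Ha : forall i, (0 <= a i)%R) by (intros i; apply Cmod_ge_0).
destruct (completeness
  (fun x => exists G, NoDup G /\ x = rsum a G)) as [S [HS1 HS2]].
- exists B; intros x [G [Hd ->]]; apply HB, Hd.
- exists 0%R, nil; split; [constructor|reflexivity].
- assert (Hc : exists s, filterlim (lsum f) finite_subsets (locally s)).
  { apply (filterlim_locally_cauchy (U := C_CompleteNormedModule)).
    intros eps.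
    assert (Hex : exists F, NoDup F /\ (S - eps / 2 < rsum a F)%R).
    { apply Classical_Prop.NNPP; intros Hn.
      assert (S <= S - eps / 2)%R; [|destruct eps; simpl in *; lra].
      apply HS2; intros x [G [Hd ->]].
      apply Rnot_lt_le; intros Hlt; apply Hn; exists G; auto. }
    destruct Hex as [F [HdF HF]].
    assert (Htail : forall G, NoDup G -> incl F G ->
              (Cmod (lsum f G - lsum f F) < eps / 2)%R).
    { intros G Hd Hi; destruct (NoDup_incl_split F G HdF Hi) as [H' HP].
      rewrite (lsum_perm f _ _ HP), lsum_app.
      replace (_ - _) with (lsum f H') by ring.
      eapply Rle_lt_trans; [apply Cmod_lsum_le|].
      assert (rsum a G <= S)%R by (apply HS1; exists G; auto).
      rewrite (rsum_perm a _ _ HP), rsum_app in H; fold a; lra. }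
    exists (fun G => Cmod (lsum f G - lsum f F) < eps / 2)%R; split.
    + exists F; exact Htail.
    + intros u v Hu Hv; apply (C_NormedModule_mixin_compat1 (lsum f u)).
      change (Cmod (lsum f v - lsum f u) < eps)%R.
      replace (lsum f v - lsum f u)
        with ((lsum f v - lsum f F) + - (lsum f u - lsum f F)) by ring.
      eapply Rle_lt_trans; [apply Cmod_triangle|].
      rewrite Cmod_opp; lra. }
  destruct Hc as [s Hs]; exists s; apply is_sum_over_filterlim, Hs.
Qed.

Lemma Cmod_is_sum_le {I : Type} (f : I -> C) (B : R) (s : C) :
  bounded_sums f B -> is_sum_over f s -> (Cmod s <= B)%R.
Proof.
intros HB H; apply Rnot_lt_le; intros Hlt.
assert (He : (0 < Cmod s - B)%R) by lra.
destruct (H (mkposreal _ He)) as [F HF]; simpl in HF.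
set (G := list_union F nil).
assert (Hd : NoDup G) by apply list_union_NoDup.
specialize (HF G Hd (incl_list_union_l F nil)).
specialize (HB G Hd).
assert (H1 := Cmod_lsum_le f G).
assert (H2 := Cmod_triangle (lsum f G) (- (lsum f G - s))).
replace (lsum f G + - (lsum f G - s)) with s in H2 by ring.
rewrite Cmod_opp in H2; unfold lsum in *; lra.
Qed.

Lemma bounded_sums_le {I : Type} (f : I -> C) (a : I -> R) (B : R) :
  (forall i, Cmod (f i) <= a i)%R ->
  (forall G, NoDup G -> rsum a G <= B)%R -> bounded_sums f B.
Proof.
intros Ha HB G Hd; eapply Rle_trans; [|apply HB, Hd].
apply rsum_le; auto.
Qed.

(** A finite set of rows is approximated, to any accuracy, by one finite set of
    pairs that also contains a prescribed finite part of the double sum. *)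
Lemma is_sum_over_Fubini {I J : Type} (f : I * J -> C) (r : I -> C) (s : C) :
  is_sum_over f s -> (forall i, is_sum_over (fun j => f (i, j)) (r i)) ->
  is_sum_over r s.
Proof.
intros Hs Hr eps.
assert (He2 : (0 < eps / 2)%R) by (destruct eps; simpl; lra).
destruct (Hs (mkposreal _ He2)) as [F HF]; simpl in HF.
exists (map fst F); intros G Hd Hi.
(* For any tolerance e, each row of G is approximated by a finite part
   containing the corresponding row of F. *)
assert (Hrows : forall (e : posreal) (G0 : list I), NoDup G0 ->
  exists H : list (I * J), NoDup H /\
    (forall i j, In (i, j) H -> In i G0) /\
    (forall i j, In (i, j) F -> In i G0 -> In (i, j) H) /\
    (Cmod (lsum f H - lsum r G0) <= INR (length G0) * e)%R).
{ intros e G0; induction G0 as [|i G0 IH]; intros Hd0.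
  - exists nil; split; [constructor|].
    split; [intros i j []|split; [intros i j _ []|]].
    unfold lsum; simpl; replace (0 - 0) with (RtoC 0) by ring.
    rewrite Cmod_0; lra.
  - inversion Hd0 as [|? ? Hni Hd0']; subst.
    destruct (IH Hd0') as [H [HdH [HH1 [HH2 HH3]]]].
    destruct (Hr i e) as [Fi HFi].
    set (Gi := list_union Fi (map snd F)).
    assert (HdGi : NoDup Gi) by apply list_union_NoDup.
    exists (map (pair i) Gi ++ H); split; [|split; [|split]].
    + apply NoDup_app; [|exact HdH|].
      * apply FinFun.Injective_map_NoDup; auto.
        intros x y Hxy; injection Hxy; auto.
      * intros p Hp Hp'; apply in_map_iff in Hp; destruct Hp as [j [<- _]].
        apply HH1 in Hp'; contradiction.
    + intros i' j Hij; apply in_app_or in Hij; destruct Hij as [Hij|Hij].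
      * apply in_map_iff in Hij; destruct Hij as [j' [Hij _]].
        injection Hij; intros _ ->; left; reflexivity.
      * right; exact (HH1 _ _ Hij).
    + intros i' j HijF [<-|Hi'].
      * apply in_or_app; left; apply in_map, incl_list_union_r.
        apply (in_map snd) in HijF; exact HijF.
      * apply in_or_app; right; apply HH2; auto.
    + rewrite lsum_app, lsum_map.
      change (lsum r (i :: G0)) with (r i + lsum r G0).
      replace (_ - _) with
        ((lsum (fun j => f (i, j)) Gi - r i) + (lsum f H - lsum r G0)) by ring.
      eapply Rle_trans; [apply Cmod_triangle|].
      assert (Hlt : (Cmod (lsum (fun j => f (i, j)) Gi - r i) < e)%R)
        by (apply HFi; [exact HdGi|apply incl_list_union_l]).
      simpl length; rewrite S_INR; lra. }
assert (Hn : (0 < INR (length G) + 1)%R)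
  by (assert (H := pos_INR (length G)); lra).
assert (He3 : (0 < eps / 2 / (INR (length G) + 1))%R)
  by (apply Rdiv_lt_0_compat; assumption).
destruct (Hrows (mkposreal _ He3) G Hd) as [H [HdH [_ [HH2 HH3]]]].
simpl in HH3.
assert (HFH : (Cmod (lsum f H - s) < eps / 2)%R).
{ apply HF; [exact HdH|]; intros [i j] Hij; apply HH2; [exact Hij|].
  apply Hi; apply (in_map fst) in Hij; exact Hij. }
assert (Hb : (INR (length G) * (eps / 2 / (INR (length G) + 1)) <= eps / 2)%R).
{ apply Rle_trans with
    ((INR (length G) + 1) * (eps / 2 / (INR (length G) + 1)))%R;
    [|right; field; lra].
  apply Rmult_le_compat_r; lra. }
change (Cmod (lsum r G - s) < eps)%R.
replace (lsum r G - s) with (- (lsum f H - lsum r G) + (lsum f H - s)) by ring.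
eapply Rle_lt_trans; [apply Cmod_triangle|]; rewrite Cmod_opp; lra.
Qed.

(** The two parities are the rows of a family on [bool * Z], to which Fubini
    applies. *)
Lemma is_sum_over_even_odd (f : Z -> C) (s s0 s1 : C) :
  is_sum_over f s ->
  is_sum_over (fun n => f (2 * n)%Z) s0 ->
  is_sum_over (fun n => f (2 * n + 1)%Z) s1 ->
  s = s0 + s1.
Proof.
intros Hs H0 H1.
set (h := fun p : bool * Z => (2 * snd p + Z.b2z (fst p))%Z).
set (k := fun n : Z => (Z.odd n, Z.div2 n)).
assert (Hhk : forall n, h (k n) = n)
  by (intros n; unfold h, k; simpl fst; simpl snd; symmetry;
      apply Z.div2_odd).
assert (Hkh : forall p, k (h p) = p).
{ intros [b n]; unfold h, k; simpl fst; simpl snd; f_equal.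
  - rewrite Z.add_comm, Z.odd_add_mul_2; destruct b; reflexivity.
  - rewrite Z.div2_div.
    replace (2 * n + Z.b2z b)%Z with (n * 2 + Z.b2z b)%Z by ring.
    rewrite Z.div_add_l by lia; destruct b; simpl Z.b2z;
      [change (1 / 2)%Z with 0%Z | change (0 / 2)%Z with 0%Z]; lia. }
assert (Hp := is_sum_over_reindex h k f s Hkh Hhk Hs).
assert (Hb : is_sum_over (fun b : bool => if b then s1 else s0) s).
{ apply (is_sum_over_Fubini _ _ _ Hp); intros [|]; unfold h; simpl fst; simpl snd.
  - exact H1.
  - eapply is_sum_over_ext; [|exact H0].
    intros n; simpl Z.b2z; rewrite Z.add_0_r; reflexivity. }
rewrite (is_sum_over_unique _ _ _ Hb
  (is_sum_over_finite _ (false :: true :: nil)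
    ltac:(repeat constructor; simpl; intuition discriminate)
    ltac:(intros [|] Hn; simpl in Hn; intuition))).
unfold lsum; simpl; ring.
Qed.

(** * Summability over [Z] and [Z * Z] *)

Definition Zrange (N : nat) : list Z :=
  map Z.of_nat (seq 0 N) ++ map (fun n => (- Z.of_nat n)%Z) (seq 0 N).

Lemma In_Zrange (k : Z) (N : nat) : (Z.abs_nat k < N)%nat -> In k (Zrange N).
Proof.
intros Hk; apply in_or_app.
destruct (Z_le_gt_dec 0 k); [left|right]; apply in_map_iff;
  exists (Z.abs_nat k); (split; [lia|apply in_seq; lia]).
Qed.

(** A finite set of integers lies in some [-N, N], which covers each absolute
    value at most twice. *)
Lemma rsum_Z_abs_le (b : nat -> R) (B : R) :
  (forall k, 0 <= b k)%R -> (forall N, rsum b (seq 0 N) <= B)%R ->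
  forall G : list Z, NoDup G -> (rsum (fun k => b (Z.abs_nat k)) G <= 2 * B)%R.
Proof.
intros Hb HB G Hd.
assert (HN : exists N, forall k, In k G -> (Z.abs_nat k < N)%nat).
{ clear Hd; induction G as [|k G [N HN]]; [exists 0%nat; intros ? []|].
  exists (S (max (Z.abs_nat k) N)); intros k' [<-|Hk]; [lia|].
  specialize (HN k' Hk); lia. }
destruct HN as [N HN].
apply Rle_trans with (rsum (fun k => b (Z.abs_nat k)) (Zrange N)).
- apply rsum_incl; [intros; apply Hb|exact Hd|].
  intros k Hk; apply In_Zrange, HN, Hk.
- unfold Zrange; rewrite rsum_app, !rsum_map.
  assert (H1 : (rsum (fun n => b (Z.abs_nat (Z.of_nat n))) (seq 0 N) <= B)%R).
  { eapply Rle_trans; [|apply (HB N)]; apply rsum_le; intros n _.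
    rewrite Zabs2Nat.id; lra. }
  assert (H2 : (rsum (fun n => b (Z.abs_nat (- Z.of_nat n))) (seq 0 N) <= B)%R).
  { eapply Rle_trans; [|apply (HB N)]; apply rsum_le; intros n _.
    replace (Z.abs_nat (- Z.of_nat n)) with n by lia; lra. }
  lra.
Qed.

Lemma rsum_seq_S (b : nat -> R) (N : nat) :
  rsum b (seq 0 (S N)) = (rsum b (seq 0 N) + b N)%R.
Proof.
rewrite seq_S, rsum_app; unfold rsum at 2; simpl; ring.
Qed.

Lemma rsum_geometric_le (r : R) (N : nat) :
  (0 <= r < 1)%R -> (rsum (fun k => r ^ k) (seq 0 N) <= / (1 - r))%R.
Proof.
intros Hr.
assert (H : rsum (fun k => r ^ k)%R (seq 0 N) = ((1 - r ^ N) / (1 - r))%R).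
{ induction N as [|N IH].
  - unfold rsum; simpl; field; lra.
  - rewrite rsum_seq_S, IH; simpl; field; lra. }
rewrite H; unfold Rdiv; rewrite <- (Rmult_1_l (/ (1 - r))) at 2.
apply Rmult_le_compat_r; [left; apply Rinv_0_lt_compat; lra|].
assert (0 <= r ^ N)%R by (apply pow_le; lra); lra.
Qed.

(** The exponent [-3/2] is large enough for convergence over [Z], and small
    enough for the product of two weights to dominate the inverse cube of the
    size of a pair, see [weight2_of_cube_le]. *)
Definition weight (k : Z) : R :=
  let j := INR (S (Z.abs_nat k)) in (/ (j * sqrt j))%R.

(** [(N+1)^(-3/2) <= 2 N^(-1/2) - 2 (N+1)^(-1/2)], so the series telescopes. *)
Lemma rsum_three_halves_le (N : nat) :
  (rsum (fun k => let j := INR (S k) in / (j * sqrt j)) (seq 0 (S N))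
    <= 3 - 2 / sqrt (INR (S N)))%R.
Proof.
induction N as [|N IH].
- unfold rsum; simpl; rewrite sqrt_1; lra.
- rewrite rsum_seq_S.
  assert (HN : (0 < INR (S N))%R) by (apply lt_0_INR; lia).
  set (x := sqrt (INR (S N))) in *; set (y := sqrt (INR (S (S N)))) in *.
  assert (Hx : (0 < x)%R) by (apply sqrt_lt_R0; exact HN).
  assert (Hy : (0 < y)%R) by (apply sqrt_lt_R0; rewrite S_INR; lra).
  assert (Hx2 : (x * x = INR (S N))%R) by (apply sqrt_sqrt; lra).
  assert (Hy2 : (y * y = INR (S (S N)))%R)
    by (apply sqrt_sqrt; rewrite S_INR; lra).
  cbv zeta; fold y; rewrite <- Hy2.
  assert (Hxy : (y * y = x * x + 1)%R)
    by (rewrite Hx2, Hy2, (S_INR (S N)); reflexivity).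
  assert (Hlt : (x < y)%R).
  { apply Rnot_le_lt; intros Hle.
    assert (H := Rmult_le_compat y x y x ltac:(lra) ltac:(lra) Hle Hle); lra. }
  clear HN Hx2 Hy2.
  assert (Hkey : (/ (y * y * y) + 2 / y <= 2 / x)%R); [|lra].
  apply Rmult_le_reg_r with (x * (y * y * y))%R; [repeat apply Rmult_lt_0_compat; assumption|].
  replace ((/ (y * y * y) + 2 / y) * (x * (y * y * y)))%R
    with (x + 2 * x * (y * y))%R by (field; lra).
  replace (2 / x * (x * (y * y * y)))%R with (2 * (y * y * y))%R
    by (field; lra).
  assert (Hd : ((y - x) * (y + x) = 1)%R) by lra.
  apply Rmult_le_reg_r with (y + x)%R; [lra|].
  replace (2 * (y * y * y) * (y + x))%R
    with (2 * (y*y) * ((y - x) * (y + x)) + 2 * x * (y * y) * (y + x))%R by ring.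
  rewrite Hd; nra.
Qed.

Lemma weight_pos (k : Z) : (0 < weight k)%R.
Proof.
unfold weight; apply Rinv_0_lt_compat.
assert (H : (0 < INR (S (Z.abs_nat k)))%R) by (apply lt_0_INR; lia).
apply Rmult_lt_0_compat; [exact H|apply sqrt_lt_R0, H].
Qed.

Lemma rsum_weight_le (G : list Z) : NoDup G -> (rsum weight G <= 6)%R.
Proof.
intros Hd.
assert (Hp : forall n, (0 < INR (S n))%R) by (intros n; apply lt_0_INR; lia).
replace 6%R with (2 * 3)%R by ring.
apply (rsum_Z_abs_le (fun k => let j := INR (S k) in / (j * sqrt j))%R);
  [| |exact Hd].
- intros k; left; apply Rinv_0_lt_compat, Rmult_lt_0_compat; [apply Hp|apply sqrt_lt_R0, Hp].
- intros [|N]; [unfold rsum; simpl; lra|].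
  eapply Rle_trans; [apply rsum_three_halves_le|].
  assert (0 < 2 / sqrt (INR (S N)))%R
    by (apply Rdiv_lt_0_compat; [lra|apply sqrt_lt_R0, Hp]); lra.
Qed.

Lemma rsum_list_prod {I J : Type} (a : I -> R) (b : J -> R) (G : list I)
    (H : list J) :
  rsum (fun p => a (fst p) * b (snd p))%R (list_prod G H)
  = (rsum a G * rsum b H)%R.
Proof.
induction G as [|i G IH]; [unfold rsum; simpl; ring|].
simpl list_prod; rewrite rsum_app, IH, rsum_map; simpl fst; simpl snd.
rewrite rsum_scal; unfold rsum; simpl; ring.
Qed.

Lemma rsum_prod_le {I J : Type} (a : I -> R) (b : J -> R) (A B : R) :
  (forall i, 0 <= a i)%R -> (forall j, 0 <= b j)%R ->
  (forall G, NoDup G -> rsum a G <= A)%R ->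
  (forall G, NoDup G -> rsum b G <= B)%R ->
  forall G, NoDup G -> (rsum (fun p => a (fst p) * b (snd p)) G <= A * B)%R.
Proof.
intros Ha Hb HA HB G Hd.
set (G1 := list_union (map fst G) nil).
set (G2 := list_union (map snd G) nil).
apply Rle_trans with
  (rsum (fun p => a (fst p) * b (snd p))%R (list_prod G1 G2)).
- apply rsum_incl; [|exact Hd|].
  + intros p; apply Rmult_le_pos; auto.
  + intros [i j] Hp; apply in_prod; apply incl_list_union_l.
    * apply (in_map fst) in Hp; exact Hp.
    * apply (in_map snd) in Hp; exact Hp.
- rewrite rsum_list_prod; apply Rmult_le_compat; try apply rsum_ge_0; auto.
  + apply HA, list_union_NoDup.
  + apply HB, list_union_NoDup.
Qed.

Lemma bounded_sums_weight (f : Z -> C) (K : R) :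
  (forall k, Cmod (f k) <= K * weight k)%R -> bounded_sums f (K * 6).
Proof.
intros Hf.
assert (HK : (0 <= K)%R).
{ assert (H := Hf 0%Z); assert (H0 := Cmod_ge_0 (f 0%Z)).
  assert (H1 := weight_pos 0); nra. }
apply bounded_sums_le with (1 := Hf); intros G Hd.
rewrite rsum_scal; apply Rmult_le_compat_l; [exact HK|].
apply rsum_weight_le, Hd.
Qed.

Lemma bounded_sums_weight2 (f : Z * Z -> C) (K : R) :
  (forall p, Cmod (f p) <= K * (weight (fst p) * weight (snd p)))%R ->
  bounded_sums f (K * 36).
Proof.
intros Hf.
assert (HK : (0 <= K)%R).
{ assert (H := Hf (0%Z, 0%Z)); assert (H0 := Cmod_ge_0 (f (0%Z, 0%Z))).
  assert (H1 := weight_pos 0); simpl in H.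
  assert (H2 : (0 < weight 0 * weight 0)%R) by nra; nra. }
apply bounded_sums_le with (1 := Hf); intros G Hd.
rewrite rsum_scal; apply Rmult_le_compat_l; [exact HK|].
replace 36%R with (6 * 6)%R by ring.
apply rsum_prod_le; try exact Hd; try apply rsum_weight_le;
  intros; left; apply weight_pos.
Qed.

Lemma bounded_sums_geometric (f : Z -> C) (K r : R) :
  (0 <= r < 1)%R -> (forall k, Cmod (f k) <= K * r ^ Z.abs_nat k)%R ->
  bounded_sums f (K * (2 * / (1 - r))).
Proof.
intros Hr Hf.
assert (HK : (0 <= K)%R).
{ assert (H := Hf 0%Z); assert (H0 := Cmod_ge_0 (f 0%Z)); simpl in H; lra. }
apply bounded_sums_le with (1 := Hf); intros G Hd.
rewrite rsum_scal; apply Rmult_le_compat_l; [exact HK|].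
apply (rsum_Z_abs_le (fun k => r ^ k)%R); [| |exact Hd].
- intros k; apply pow_le; lra.
- intros N; apply rsum_geometric_le, Hr.
Qed.

Lemma weight_of_square_le (k : Z) (x : R) :
  (INR (S (Z.abs_nat k)) <= x)%R -> (/ (x * x) <= weight k)%R.
Proof.
intros Hx; unfold weight; cbv zeta.
set (j := INR (S (Z.abs_nat k))) in *.
assert (Hj : (1 <= j)%R).
{ unfold j; rewrite S_INR; assert (H := pos_INR (Z.abs_nat k)); lra. }
assert (Hs0 : (0 < sqrt j)%R) by (apply sqrt_lt_R0; lra).
assert (Hs : (sqrt j * sqrt j = j)%R) by (apply sqrt_sqrt; lra).
assert (Hs1 : (sqrt j <= j)%R) by nra.
apply Rinv_le_contravar; nra.
Qed.

(** With [j, k <= x] one has [(j k)^(3/2) <= x^3]. *)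
Lemma weight2_of_cube_le (p : Z * Z) (x : R) :
  (INR (S (Z.abs_nat (fst p))) <= x)%R ->
  (INR (S (Z.abs_nat (snd p))) <= x)%R ->
  (/ (x * x * x) <= weight (fst p) * weight (snd p))%R.
Proof.
unfold weight; cbv zeta; intros H1 H2.
set (j := INR (S (Z.abs_nat (fst p)))) in *.
set (k := INR (S (Z.abs_nat (snd p)))) in *.
assert (Hj : (0 < j)%R) by (apply lt_0_INR; lia).
assert (Hk : (0 < k)%R) by (apply lt_0_INR; lia).
assert (Hsj : (0 < sqrt j)%R) by (apply sqrt_lt_R0; exact Hj).
assert (Hsk : (0 < sqrt k)%R) by (apply sqrt_lt_R0; exact Hk).
rewrite <- Rinv_mult.
apply Rinv_le_contravar.
- apply Rmult_lt_0_compat; apply Rmult_lt_0_compat; assumption.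
- replace (j * sqrt j * (k * sqrt k))%R with (j * k * (sqrt j * sqrt k))%R
    by ring.
  assert (Hs : (sqrt j * sqrt k <= x)%R).
  { rewrite <- sqrt_mult by lra.
    rewrite <- (sqrt_square x) by lra.
    apply sqrt_le_1; nra. }
  apply Rmult_le_compat; try nra.
Qed.

Lemma finite_positive_lower_bound {I : Type} (g : I -> R) (l : list I) :
  exists d, (0 < d)%R /\ forall i, In i l -> (0 < g i)%R -> (d <= g i)%R.
Proof.
induction l as [|i l [d [Hd IH]]].
- exists 1%R; split; [lra|intros i []].
- destruct (Rlt_le_dec 0 (g i)) as [Hi|Hi].
  + exists (Rmin d (g i)); split; [apply Rmin_case; assumption|].
    intros j [<-|Hj] Hgj; [apply Rmin_r|].
    eapply Rle_trans; [apply Rmin_l|apply IH; assumption].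
  + exists d; split; [exact Hd|].
    intros j [<-|Hj] Hgj; [lra|apply IH; assumption].
Qed.

(** * Complex derivatives and the exponential *)

Lemma Cmod_le_Re_Im (z : C) : (Cmod z <= Rabs (Re z) + Rabs (Im z))%R.
Proof.
destruct z as [x y]; simpl Re; simpl Im.
replace (x, y) with (RtoC x + Ci * RtoC y)
  by (apply injective_projections; simpl; ring).
eapply Rle_trans; [apply Cmod_triangle|].
rewrite Cmod_mult, Cmod_Ci, !Cmod_R; lra.
Qed.

Lemma Im_le_Cmod (z : C) : (Rabs (Im z) <= Cmod z)%R.
Proof.
eapply Rle_trans; [apply Rmax_r|apply Rmax_Cmod].
Qed.

Lemma Cmod_minus_ge (z w : C) : (Cmod z - Cmod w <= Cmod (z - w))%R.
Proof.
assert (H := Cmod_triangle (z - w) w).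
replace (z - w + w) with z in H by ring; lra.
Qed.

Lemma Cmod_minus_sym (z w : C) : Cmod (z - w) = Cmod (w - z).
Proof. rewrite <- Cmod_opp; f_equal; ring. Qed.

Lemma Cmod_minus_le (z w : C) : (Cmod (z - w) <= Cmod z + Cmod w)%R.
Proof.
assert (H := Cmod_triangle z (- w)); rewrite Cmod_opp in H; exact H.
Qed.

(** [C] is a normed module over itself in two ways, with the same norm: the
    uniform structure is that of the discs or that of the product [R * R]. *)
Lemma is_derive_C_AbsRing (f : C -> C) (z l : C) :
  is_derive (V := AbsRing_NormedModule C_AbsRing) f z l <-> is_derive f z l.
Proof.
split; intros [[H1 H2 H3] H]; (split; [constructor; assumption|exact H]).
Qed.

Lemma is_C_derive_plus (f g : C -> C) (z df dg : C) :
  is_derive f z df -> is_derive g z dg ->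
  is_derive (fun w => f w + g w) z (df + dg).
Proof. exact (is_derive_plus f g z df dg). Qed.

Lemma is_C_derive_const (a z : C) : is_derive (fun _ : C => a) z (RtoC 0).
Proof. exact (is_derive_const (V := C_NormedModule) a z). Qed.

Lemma is_C_derive_id (z : C) : is_derive (fun w : C => w) z (RtoC 1).
Proof. apply is_derive_C_AbsRing; exact (is_derive_id (K := C_AbsRing) z). Qed.

Lemma is_C_derive_mult (f g : C -> C) (z df dg : C) :
  is_derive f z df -> is_derive g z dg ->
  is_derive (fun w => f w * g w) z (df * g z + f z * dg).
Proof.
rewrite <- !is_derive_C_AbsRing; intros Hf Hg.
exact (is_derive_mult (K := C_AbsRing) f g z df dg Hf Hg Cmult_comm).
Qed.

Lemma is_C_derive_scal (c : C) (f : C -> C) (z df : C) :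
  is_derive f z df -> is_derive (fun w => c * f w) z (c * df).
Proof.
intros Hf; replace (c * df) with (0 * f z + c * df) by ring.
apply (is_C_derive_mult (fun _ => c)); [apply is_C_derive_const|exact Hf].
Qed.

Lemma is_C_derive_minus (f g : C -> C) (z df dg : C) :
  is_derive f z df -> is_derive g z dg ->
  is_derive (fun w => f w - g w) z (df - dg).
Proof. exact (is_derive_minus f g z df dg). Qed.

Lemma is_C_derive_comp (f g : C -> C) (z df dg : C) :
  is_derive f (g z) df -> is_derive g z dg ->
  is_derive (fun w => f (g w)) z (dg * df).
Proof.
intros Hf Hg; apply is_derive_C_AbsRing in Hg.
exact (is_derive_comp (K := C_AbsRing) (V := C_NormedModule) f g z df dg Hf Hg).
Qed.

Lemma locally_AbsRing_Cmod (z : C) (P : C -> Prop) (d : posreal) :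
  (forall w, (Cmod (w - z) < d)%R -> P w) ->
  locally (T := AbsRing_UniformSpace C_AbsRing) z P.
Proof. intros H; exists d; intros w Hw; apply H, Hw. Qed.

Lemma is_C_derive_ext_loc (f g : C -> C) (z l : C) (d : posreal) :
  (forall w, (Cmod (w - z) < d)%R -> f w = g w) ->
  is_derive f z l -> is_derive g z l.
Proof.
intros H; apply is_derive_ext_loc, (locally_AbsRing_Cmod z _ d), H.
Qed.

(** A quadratic remainder with an explicit constant can be majorized term by
    term in a series, which a remainder of type little-o cannot. *)
Lemma is_C_derive_square (f : C -> C) (z l : C) (d : posreal) (K : R) :
  (forall w, (Cmod (w - z) < d)%R ->
    (Cmod (f w - f z - (w - z) * l) <= K * (Cmod (w - z) * Cmod (w - z)))%R) ->
  is_derive f z l.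
Proof.
intros H; split.
- exact (is_linear_scal_l (V := C_NormedModule) l).
- intros x Hx.
  apply (is_filter_lim_locally_unique (V := AbsRing_NormedModule C_AbsRing)) in Hx.
  subst x; intros eps.
  assert (HK : (0 < eps / (Rabs K + 1))%R).
  { apply Rdiv_lt_0_compat; [apply cond_pos|].
    assert (HK := Rabs_pos K); lra. }
  assert (Hm : (0 < Rmin d (eps / (Rabs K + 1)))%R)
    by (apply Rmin_case; [apply cond_pos|exact HK]).
  apply (locally_AbsRing_Cmod z _ (mkposreal _ Hm)); simpl pos.
  intros w Hw.
  change (Cmod (f w - f z - (w - z) * l) <= eps * Cmod (w - z))%R.
  eapply Rle_trans; [apply H; eapply Rlt_le_trans; [exact Hw|apply Rmin_l]|].
  rewrite <- Rmult_assoc; apply Rmult_le_compat_r; [apply Cmod_ge_0|].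
  assert (Hw2 : (Cmod (w - z) <= eps / (Rabs K + 1))%R)
    by (left; eapply Rlt_le_trans; [exact Hw|apply Rmin_r]).
  apply Rle_trans with ((Rabs K + 1) * (eps / (Rabs K + 1)))%R.
  + assert (H1 := Rle_abs K); assert (H2 := Rabs_pos K).
    apply Rle_trans with ((Rabs K + 1) * Cmod (w - z))%R.
    * apply Rmult_le_compat_r; [apply Cmod_ge_0|lra].
    * apply Rmult_le_compat_l; [lra|exact Hw2].
  + right; field; assert (H2 := Rabs_pos K); lra.
Qed.

Lemma Cexp_plus (z w : C) : Cexp (z + w) = Cexp z * Cexp w.
Proof.
destruct z as [x y], w as [x' y']; unfold Cexp; simpl Re; simpl Im.
rewrite exp_plus, cos_plus, sin_plus.
apply injective_projections; simpl; ring.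
Qed.

Lemma Cexp_0 : Cexp 0 = 1.
Proof.
unfold Cexp; simpl; rewrite exp_0, cos_0, sin_0.
apply injective_projections; simpl; ring.
Qed.

Lemma Cexp_opp (z : C) : Cexp (- z) = / Cexp z.
Proof.
assert (H : Cexp z * Cexp (- z) = 1).
{ rewrite <- Cexp_plus; replace (z + - z) with (RtoC 0) by ring; apply Cexp_0. }
assert (Hz := Cexp_neq_0 z).
replace (Cexp (- z)) with (/ Cexp z * (Cexp z * Cexp (- z))) by (field; exact Hz).
rewrite H; ring.
Qed.

Lemma Cexp_minus (z w : C) : Cexp (z - w) = Cexp z / Cexp w.
Proof.
unfold Cminus; rewrite Cexp_plus, Cexp_opp; reflexivity.
Qed.

Lemma Cmod_unit_circle (t : R) : Cmod (cos t, sin t) = 1%R.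
Proof.
unfold Cmod; simpl fst; simpl snd.
replace (cos t ^ 2 + sin t ^ 2)%R with 1%R; [apply sqrt_1|].
assert (H := sin2_cos2 t); unfold Rsqr in H; simpl; lra.
Qed.

Lemma Cmod_Cexp (z : C) : Cmod (Cexp z) = exp (Re z).
Proof.
unfold Cexp; rewrite Cmod_mult, Cmod_R, Cmod_unit_circle, Rmult_1_r.
apply Rabs_pos_eq; left; apply exp_pos.
Qed.

Lemma Cexp_surj (w : C) : w <> 0 -> exists z, Cexp z = w.
Proof.
intros Hw.
assert (Hr : (0 < Cmod w)%R) by (apply Cmod_gt_0; exact Hw).
destruct w as [a b]; set (r := Cmod (a, b)) in *.
assert (Hr2 : (a * a + b * b = r * r)%R).
{ unfold r, Cmod; rewrite sqrt_sqrt by (simpl; nra); simpl; ring. }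
assert (Hu : ((a / r) * (a / r) + (b / r) * (b / r) = 1)%R).
{ replace ((a / r) * (a / r) + (b / r) * (b / r))%R
    with ((a * a + b * b) / (r * r))%R by (field; lra).
  rewrite Hr2; field; lra. }
set (c := (a / r)%R) in *; set (s := (b / r)%R) in *.
assert (Hc : (-1 <= c <= 1)%R) by (split; nra).
assert (Ht : exists t, cos t = c /\ sin t = s).
{ assert (Hsq : sqrt (1 - c²) = Rabs s).
  { rewrite <- sqrt_Rsqr_abs; f_equal; unfold Rsqr; lra. }
  destruct (Rle_lt_dec 0 s).
  - exists (acos c); rewrite cos_acos, sin_acos, Hsq by exact Hc.
    split; [reflexivity|apply Rabs_pos_eq; assumption].
  - exists (- acos c)%R.
    rewrite cos_neg, sin_neg, cos_acos, sin_acos, Hsq by exact Hc.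
    split; [reflexivity|rewrite Rabs_left by assumption; ring]. }
destruct Ht as [t [Hct Hst]].
exists (ln r, t); unfold Cexp; simpl Re; simpl Im.
rewrite exp_ln, Hct, Hst by exact Hr.
apply injective_projections; simpl; unfold c, s; field; lra.
Qed.

Lemma PI_C_neq_0 : RtoC PI <> 0.
Proof. intros H; apply RtoC_inj in H; assert (Hp := PI_RGT_0); lra. Qed.

Lemma two_pi_i_neq_0 : two_pi_i <> 0.
Proof.
unfold two_pi_i; repeat apply Cmult_neq_0.
- intros H; apply RtoC_inj in H; lra.
- apply PI_C_neq_0.
- apply Ci_nz.
Qed.

Lemma two_pi_i_eq : two_pi_i = (0, 2 * PI)%R.
Proof. unfold two_pi_i; apply injective_projections; simpl; ring. Qed.

Lemma Cexp_eq_1 (z : C) : Cexp z = 1 -> exists k : Z, z = two_pi_i * ZtoC k.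
Proof.
intros H.
assert (Hm := Cmod_Cexp z); rewrite H, Cmod_1, <- exp_0 in Hm.
apply exp_inv in Hm.
destruct z as [x y]; simpl in Hm; subst x.
unfold Cexp in H; simpl Re in H; simpl Im in H.
rewrite exp_0 in H.
assert (Hc : cos y = 1%R) by (apply (f_equal fst) in H; simpl in H; lra).
replace y with (2 * (y / 2))%R in Hc by field.
rewrite cos_2a_sin in Hc.
assert (Hs : sin (y / 2) = 0%R) by nra.
apply sin_eq_0_0 in Hs; destruct Hs as [k Hk]; exists k.
rewrite two_pi_i_eq; unfold ZtoC.
apply injective_projections; simpl; lra.
Qed.

Lemma Cexp_two_pi_i_Z (k : Z) : Cexp (two_pi_i * ZtoC k) = 1.
Proof.
assert (Hs : sin (IZR k * PI) = 0%R) by (apply sin_eq_0_1; exists k; reflexivity).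
rewrite two_pi_i_eq; unfold Cexp, ZtoC; simpl Re; simpl Im.
replace (0 * IZR k - 2 * PI * 0)%R with 0%R by ring.
replace (0 * 0 + 2 * PI * IZR k)%R with (2 * (IZR k * PI))%R by ring.
rewrite exp_0, cos_2a_sin, sin_2a, Hs.
apply injective_projections; simpl; ring.
Qed.

Lemma Cexp_eq (z w : C) :
  Cexp z = Cexp w -> exists k : Z, z = w + two_pi_i * ZtoC k.
Proof.
intros H; destruct (Cexp_eq_1 (z - w)) as [k Hk].
- rewrite Cexp_minus, H; field; apply Cexp_neq_0.
- exists k; rewrite <- Hk; ring.
Qed.

Lemma ZtoC_plus (m n : Z) : ZtoC (m + n) = ZtoC m + ZtoC n.
Proof. unfold ZtoC; rewrite plus_IZR, RtoC_plus; reflexivity. Qed.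

Lemma ZtoC_opp (m : Z) : ZtoC (- m) = - ZtoC m.
Proof. unfold ZtoC; rewrite opp_IZR, RtoC_opp; reflexivity. Qed.

Lemma ZtoC_mult (m n : Z) : ZtoC (m * n) = ZtoC m * ZtoC n.
Proof. unfold ZtoC; rewrite mult_IZR, RtoC_mult; reflexivity. Qed.

Lemma Cexp_nat_mult (z : C) (n : nat) :
  Cexp z ^ n = Cexp (z * RtoC (INR n)).
Proof.
induction n as [|n IH].
- simpl; rewrite Cmult_0_r, Cexp_0; reflexivity.
- rewrite Cpow_S, IH, <- Cexp_plus, S_INR, RtoC_plus; f_equal; ring.
Qed.

Lemma Cpowz_Cexp (z : C) (m : Z) : Cpowz (Cexp z) m = Cexp (z * ZtoC m).
Proof.
destruct m as [|p|p]; unfold Cpowz, ZtoC.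
- rewrite Cmult_0_r, Cexp_0; reflexivity.
- rewrite Cexp_nat_mult, INR_IZR_INZ, positive_nat_Z; reflexivity.
- rewrite Cexp_nat_mult, <- Cexp_opp, INR_IZR_INZ, positive_nat_Z.
  change (Z.neg p) with (- Z.pos p)%Z; rewrite opp_IZR, RtoC_opp.
  f_equal; ring.
Qed.

Lemma Rabs_sin_le (y : R) : (Rabs (sin y) <= Rabs y)%R.
Proof.
replace (sin y) with (sin y - sin 0)%R by (rewrite sin_0; ring).
replace (Rabs y) with (1 * Rabs (y - 0))%R by (rewrite Rminus_0_r; ring).
apply (bounded_variation sin cos); intros t _; split.
- apply is_derive_Reals, derivable_pt_lim_sin.
- apply Rabs_le; apply COS_bound.
Qed.

Lemma Rabs_cos_minus_1_le (y : R) : (Rabs (cos y - 1) <= y * y / 2)%R.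
Proof.
replace y with (2 * (y / 2))%R at 1 by field; rewrite cos_2a_sin.
replace (1 - 2 * sin (y / 2) * sin (y / 2) - 1)%R
  with (- (2 * (sin (y / 2) * sin (y / 2))))%R by ring.
rewrite Rabs_Ropp, !Rabs_mult, (Rabs_pos_eq 2) by lra.
assert (H := Rabs_sin_le (y / 2)); assert (H0 := Rabs_pos (sin (y / 2))).
assert (Hy : (Rabs (y / 2) * Rabs (y / 2) = y * y / 4)%R)
  by (rewrite <- Rabs_mult, Rabs_pos_eq by nra; field).
nra.
Qed.

Lemma Rabs_sin_minus_id_le (y : R) :
  (Rabs (sin y - y) <= Rabs y * Rabs y * Rabs y / 2)%R.
Proof.
replace (sin y - y)%R with ((sin y - y) - (sin 0 - 0))%R
  by (rewrite sin_0; ring).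
replace (Rabs y * Rabs y * Rabs y / 2)%R
  with (Rabs y * Rabs y / 2 * Rabs (y - 0))%R by (rewrite Rminus_0_r; field).
apply (bounded_variation (fun t => sin t - t)%R (fun t => cos t - 1)%R).
intros t Ht; rewrite !Rminus_0_r in Ht; split.
- auto_derive; [exact I|ring].
- eapply Rle_trans; [apply Rabs_cos_minus_1_le|].
  replace (t * t)%R with (Rabs t * Rabs t)%R
    by (rewrite <- Rabs_mult, Rabs_pos_eq by nra; reflexivity).
  assert (H0 := Rabs_pos t); nra.
Qed.

Lemma Rabs_exp_minus_le (x : R) :
  (Rabs x <= / 2)%R -> (Rabs (exp x - 1 - x) <= 2 * (x * x))%R.
Proof.
intros Hx; apply Rabs_le_between in Hx.
assert (H1 := exp_ineq1_le x); assert (H2 := exp_ineq1_le (- x)).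
rewrite exp_Ropp in H2; assert (H3 := exp_pos x).
rewrite Rabs_pos_eq by lra.
assert (H4 : ((1 - x) * exp x <= 1)%R).
{ replace 1%R with (/ exp x * exp x)%R at 2 by (field; lra).
  apply Rmult_le_compat_r; lra. }
assert (H5 : (exp x <= 2)%R) by nra.
assert (H6 : ((1 - x) * (exp x - 1 - x) <= x * x)%R) by nra.
nra.
Qed.

(** Real and imaginary parts are compared separately, using the second order
    remainders of [exp], [cos] and [sin]. *)
Lemma Cexp_second_order (h : C) :
  (Cmod h <= / 2)%R -> (Cmod (Cexp h - 1 - h) <= 10 * (Cmod h * Cmod h))%R.
Proof.
intros Hh; destruct h as [x y]; set (r := Cmod (x, y)) in *.
assert (Hx : (Rabs x <= r)%R) by exact (re_le_Cmod (x, y)).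
assert (Hy : (Rabs y <= r)%R) by exact (Im_le_Cmod (x, y)).
assert (Hx0 := Rabs_pos x); assert (Hy0 := Rabs_pos y).
assert (Hxx : (x * x <= r * r)%R).
{ replace (x * x)%R with (Rabs x * Rabs x)%R
    by (rewrite <- Rabs_mult, Rabs_pos_eq by nra; reflexivity); nra. }
assert (Hyy : (y * y <= r * r)%R).
{ replace (y * y)%R with (Rabs y * Rabs y)%R
    by (rewrite <- Rabs_mult, Rabs_pos_eq by nra; reflexivity); nra. }
assert (He := Rabs_exp_minus_le x ltac:(lra)).
assert (Hc := Rabs_cos_minus_1_le y); assert (Hs := Rabs_sin_minus_id_le y).
assert (Hex : (0 < exp x <= 2)%R).
{ split; [apply exp_pos|].
  apply Rabs_le_between in He.
  assert (x <= /2)%R by (assert (H := Rle_abs x); lra); nra. }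
assert (He1 : (Rabs (exp x - 1) <= 2 * r)%R).
{ replace (exp x - 1)%R with ((exp x - 1 - x) + x)%R by ring.
  eapply Rle_trans; [apply Rabs_triang|]; nra. }
eapply Rle_trans; [apply Cmod_le_Re_Im|].
replace (Re (Cexp (x, y) - 1 - (x, y)))
  with (exp x * (cos y - 1) + (exp x - 1 - x))%R by (simpl; ring).
replace (Im (Cexp (x, y) - 1 - (x, y)))
  with (exp x * (sin y - y) + y * (exp x - 1))%R by (simpl; ring).
assert (HA : (Rabs (exp x * (cos y - 1) + (exp x - 1 - x)) <= 3 * (r * r))%R).
{ eapply Rle_trans; [apply Rabs_triang|].
  rewrite Rabs_mult, (Rabs_pos_eq (exp x)) by lra.
  assert (H := Rabs_pos (cos y - 1)); nra. }
assert (HB : (Rabs (exp x * (sin y - y) + y * (exp x - 1)) <= 3 * (r * r))%R).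
{ eapply Rle_trans; [apply Rabs_triang|].
  rewrite !Rabs_mult, (Rabs_pos_eq (exp x)) by lra.
  assert (H1 : (Rabs (sin y - y) <= r * r / 4)%R).
  { eapply Rle_trans; [exact Hs|].
    assert (Rabs y * Rabs y <= r * r)%R by nra.
    assert (Rabs y * Rabs y * Rabs y <= r * r * / 2)%R; [|lra].
    apply Rmult_le_compat; nra. }
  assert (H2 : (Rabs y * Rabs (exp x - 1) <= r * (2 * r))%R)
    by (apply Rmult_le_compat; auto using Rabs_pos).
  assert (H3 := Rabs_pos (sin y - y)); nra. }
assert (0 <= r * r)%R by nra; lra.
Qed.

Lemma is_C_derive_Cexp (z : C) : is_derive Cexp z (Cexp z).
Proof.
apply (is_C_derive_square Cexp z (Cexp z) (mkposreal (/ 2) ltac:(lra))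
  (Cmod (Cexp z) * 10)); simpl pos; intros w Hw.
replace (Cexp w) with (Cexp z * Cexp (w - z))
  by (rewrite <- Cexp_plus; f_equal; ring).
replace (Cexp z * Cexp (w - z) - Cexp z - (w - z) * Cexp z)
  with (Cexp z * (Cexp (w - z) - 1 - (w - z))) by ring.
rewrite Cmod_mult, Rmult_assoc.
apply Rmult_le_compat_l; [apply Cmod_ge_0|].
apply Cexp_second_order; lra.
Qed.

(** * The partial fraction series of the squared cosecant *)

(** Half-angle: on [[0, 1]] the Taylor bounds give [sin t >= t / 2] and [cos t
    >= 1 / 2]. *)
Lemma Rabs_sin_ge (b : R) : (Rabs b <= 2)%R -> (Rabs b / 4 <= Rabs (sin b))%R.
Proof.
intros Hb.
assert (Hs := Rabs_sin_minus_id_le (b / 2)).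
assert (Hc := Rabs_cos_minus_1_le (b / 2)).
assert (H2 : Rabs (b / 2) = (Rabs b / 2)%R)
  by (unfold Rdiv; rewrite Rabs_mult, (Rabs_pos_eq (/ 2)) by lra; reflexivity).
rewrite H2 in Hs.
replace (b / 2 * (b / 2))%R with (Rabs b / 2 * (Rabs b / 2))%R in Hc
  by (rewrite <- H2, <- Rabs_mult, Rabs_pos_eq by nra; reflexivity).
assert (H0 := Rabs_pos b); set (t := (Rabs b / 2)%R) in *.
assert (Ht : (0 <= t <= 1)%R) by (unfold t; lra).
assert (Hs' : (t / 2 <= Rabs (sin (b / 2)))%R).
{ assert (H := Rabs_triang_inv (b / 2) (b / 2 - sin (b / 2))).
  replace (b / 2 - (b / 2 - sin (b / 2)))%R with (sin (b / 2)) in H by ring.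
  rewrite (Rabs_minus_sym (b / 2)), H2 in H; fold t in H; nra. }
assert (Hc' : (/ 2 <= cos (b / 2))%R)
  by (apply Rabs_le_between in Hc; nra).
replace b with (2 * (b / 2))%R at 2 by field.
rewrite sin_2a, !Rabs_mult, (Rabs_pos_eq 2), (Rabs_pos_eq (cos _)) by lra.
replace (Rabs b) with (2 * t)%R by (unfold t; field); nra.
Qed.

Lemma cosh_le (r a : R) : (Rabs a <= r)%R -> (0 <= cosh a <= exp r)%R.
Proof.
intros Ha; apply Rabs_le_between in Ha; unfold cosh.
assert (H : forall t, (t <= r)%R -> (exp t <= exp r)%R).
{ intros t [Ht| ->]; [left; apply exp_increasing, Ht|right; reflexivity]. }
assert (H1 := exp_pos a); assert (H2 := exp_pos (- a)).
assert (H3 := H a ltac:(lra)); assert (H4 := H (- a)%R ltac:(lra)); lra.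
Qed.

Lemma Rabs_sinh_le (r a : R) :
  (Rabs a <= r)%R -> (Rabs (sinh a) <= exp r * Rabs a)%R.
Proof.
intros Ha.
replace (sinh a) with (sinh a - sinh 0)%R by (rewrite sinh_0; ring).
replace (Rabs a) with (Rabs (a - 0)) by (f_equal; ring).
apply (bounded_variation sinh cosh); intros t Ht; rewrite !Rminus_0_r in Ht; split.
- apply is_derive_Reals, derivable_pt_lim_sinh.
- destruct (cosh_le r t); [lra|]; rewrite Rabs_pos_eq; lra.
Qed.

Lemma Rabs_cosh_minus_1_le (r a : R) :
  (Rabs a <= r)%R -> (Rabs (cosh a - 1) <= exp r * Rabs a * Rabs a)%R.
Proof.
intros Ha.
replace (cosh a - 1)%R with (cosh a - cosh 0)%R by (rewrite cosh_0; ring).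
replace (Rabs a) with (Rabs (a - 0)) at 2 by (f_equal; ring).
apply (bounded_variation cosh sinh); intros t Ht; rewrite !Rminus_0_r in Ht; split.
- apply is_derive_Reals, derivable_pt_lim_cosh.
- eapply Rle_trans; [apply (Rabs_sinh_le r); lra|].
  apply Rmult_le_compat_l; [left; apply exp_pos|exact Ht].
Qed.

Lemma Rabs_sinh_minus_id_le (r a : R) :
  (Rabs a <= r)%R ->
  (Rabs (sinh a - a) <= exp r * Rabs a * Rabs a * Rabs a)%R.
Proof.
intros Ha.
replace (sinh a - a)%R with ((sinh a - a) - (sinh 0 - 0))%R
  by (rewrite sinh_0; ring).
replace (Rabs a) with (Rabs (a - 0)) at 3 by (f_equal; ring).
apply (bounded_variation (fun t => sinh t - t)%R (fun t => cosh t - 1)%R).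
intros t Ht; rewrite !Rminus_0_r in Ht; split.
- apply (is_derive_minus (V := R_NormedModule) sinh (fun t => t) t (cosh t) 1%R).
  + apply is_derive_Reals, derivable_pt_lim_sinh.
  + exact (is_derive_id (K := R_AbsRing) t).
- eapply Rle_trans; [apply (Rabs_cosh_minus_1_le r); lra|].
  assert (H0 := Rabs_pos t); assert (H1 := exp_pos r).
  rewrite !Rmult_assoc; apply Rmult_le_compat_l; [lra|].
  apply Rmult_le_compat; lra.
Qed.

Lemma Rabs_sinh_ge (a : R) : (Rabs a <= Rabs (sinh a))%R.
Proof.
assert (Hpos : forall t, (0 <= t)%R -> (t <= sinh t)%R).
{ intros t Ht.
  assert (H1 := exp_ineq1_le t).
  destruct Ht as [Ht|<-]; [|rewrite sinh_0; lra].
  destruct (MVT_cor2 sinh cosh 0 t Ht) as [c [Hc Hc']].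
  { intros c _; apply derivable_pt_lim_sinh. }
  rewrite sinh_0, !Rminus_0_r in Hc.
  assert (H2 := exp_ineq1_le c).
  assert (Hcosh : (1 <= cosh c)%R).
  { unfold cosh; assert (H3 := exp_pos c).
    assert (H4 : (exp c * exp (- c) = 1)%R)
      by (rewrite <- exp_plus, Rplus_opp_r; apply exp_0).
    assert (H5 := exp_pos (- c)); nra. }
  rewrite Hc; nra. }
destruct (Rle_lt_dec 0 a) as [Ha|Ha].
- assert (H := Hpos a Ha); rewrite !Rabs_pos_eq; lra.
- assert (H := Hpos (- a)%R ltac:(lra)).
  assert (Hodd : sinh (- a) = (- sinh a)%R)
    by (unfold sinh; rewrite Ropp_involutive; field).
  rewrite Hodd in H; rewrite !Rabs_left; lra.
Qed.

(** [sin (PI v) / PI], normalized to have derivative [1] at [0]. *)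
Definition Csinpi (v : C) : C :=
  (Cexp (two_pi_i * (v / 2)) - / Cexp (two_pi_i * (v / 2))) / two_pi_i.

Lemma Cinv_neq_0 (z : C) : z <> 0 -> / z <> 0.
Proof.
intros Hz H; apply C1_nz; rewrite <- (Cinv_r z Hz), H; ring.
Qed.

Lemma RtoC_2_neq_0 : RtoC 2 <> 0.
Proof. intros H; apply RtoC_inj in H; lra. Qed.

Lemma Csinpi_Re_Im (x y : R) :
  Csinpi (x, y) =
  ((sin (PI * x) * cosh (PI * y) / PI)%R, (cos (PI * x) * sinh (PI * y) / PI)%R).
Proof.
unfold Csinpi; rewrite <- Cexp_opp.
assert (HPI := PI_RGT_0).
assert (E1 : two_pi_i * ((x, y) / 2) = ((- (PI * y))%R, (PI * x)%R)).
{ rewrite two_pi_i_eq; apply injective_projections; simpl; field. }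
rewrite E1.
assert (E2 : - ((- (PI * y))%R, (PI * x)%R) = ((PI * y)%R, (- (PI * x))%R)).
{ apply injective_projections; simpl; ring. }
rewrite E2; unfold Cexp; simpl Re; simpl Im.
rewrite cos_neg, sin_neg.
assert (E3 : forall z, z / two_pi_i = ((Im z / (2 * PI))%R, (- Re z / (2 * PI))%R)).
{ intros [a b]; rewrite two_pi_i_eq; apply injective_projections; simpl;
    field; lra. }
rewrite E3; unfold cosh, sinh.
apply injective_projections; simpl; field; lra.
Qed.

Lemma Cmod_sqr (z : C) : (Cmod z * Cmod z = Re z * Re z + Im z * Im z)%R.
Proof.
destruct z as [x y]; unfold Cmod; rewrite sqrt_sqrt by (simpl; nra); simpl; ring.
Qed.

(** With [b = PI Re v] and [a = PI Im v], [|sin (PI v)|^2 = sin^2 b + sinh^2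
    a]. *)
Lemma Cmod_Csinpi_ge (v : C) :
  (Rabs (Re v) <= / 2)%R -> (Cmod v / 4 <= Cmod (Csinpi v))%R.
Proof.
destruct v as [x y]; simpl Re; intros Hx.
assert (HPI := PI_RGT_0); assert (HPI4 := PI_4).
rewrite Csinpi_Re_Im.
assert (Hb : (Rabs (PI * x) / 4 <= Rabs (sin (PI * x)))%R).
{ apply Rabs_sin_ge; rewrite Rabs_mult, (Rabs_pos_eq PI) by lra.
  assert (H := Rabs_pos x); nra. }
assert (Ha := Rabs_sinh_ge (PI * y)).
apply Rsqr_incr_0; try apply Cmod_ge_0;
  [|assert (H := Cmod_ge_0 (x, y)); lra].
unfold Rsqr; rewrite Cmod_sqr; simpl Re; simpl Im.
replace (Cmod (x, y) / 4 * (Cmod (x, y) / 4))%R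
  with ((x * x + y * y) / 16)%R
  by (assert (H := Cmod_sqr (x, y)); simpl Re in H; simpl Im in H; lra).
set (s := sin (PI * x)) in *; set (c := cos (PI * x)).
set (sh := sinh (PI * y)) in *; set (ch := cosh (PI * y)).
assert (Hsc : (s * s + c * c = 1)%R)
  by (assert (H := sin2_cos2 (PI * x)); unfold Rsqr in H; exact H).
assert (Hch : (ch * ch = 1 + sh * sh)%R).
{ unfold ch, sh, cosh, sinh.
  assert (H4 : (exp (PI * y) * exp (- (PI * y)) = 1)%R)
    by (rewrite <- exp_plus, Rplus_opp_r; apply exp_0).
  lra. }
replace (s * ch / PI * (s * ch / PI) + c * sh / PI * (c * sh / PI))%R
  with ((s * s + sh * sh) / (PI * PI))%R.
2:{ replace (s * ch / PI * (s * ch / PI) + c * sh / PI * (c * sh / PI))%R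
      with ((s * s * (ch * ch) + c * c * (sh * sh)) / (PI * PI))%R
      by (field; lra).
    rewrite Hch; replace (c * c)%R with (1 - s * s)%R by lra; field; lra. }
assert (Hsq : forall t u : R, (Rabs t <= Rabs u)%R -> (t * t <= u * u)%R).
{ intros t u Htu; apply Rsqr_le_abs_1 in Htu; exact Htu. }
assert (H1 : (PI * x / 4 * (PI * x / 4) <= s * s)%R).
{ apply Hsq; unfold Rdiv; rewrite Rabs_mult, (Rabs_pos_eq (/ 4)) by lra; lra. }
assert (H2 : (PI * y * (PI * y) <= sh * sh)%R) by (apply Hsq; exact Ha).
apply Rmult_le_reg_r with (PI * PI)%R; [nra|].
replace ((s * s + sh * sh) / (PI * PI) * (PI * PI))%R with (s * s + sh * sh)%R
  by (field; lra).
assert (0 <= PI * y * (PI * y))%R by nra; nra.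
Qed.

(** The absence of a quadratic term is what makes the double poles cancel
    completely in [koebe_minus_pole_bounded]. *)
Lemma Csinpi_third_order :
  exists K, (0 <= K)%R /\ forall v, (Cmod v <= 1)%R ->
    (Cmod (Csinpi v - v) <= K * (Cmod v * Cmod v * Cmod v))%R.
Proof.
assert (HPI := PI_RGT_0); set (E := exp PI).
assert (HE : (0 < E)%R) by apply exp_pos.
exists (4 * E * (PI * PI))%R; split; [nra|].
intros [x y] Hv; set (r := Cmod (x, y)) in *; rewrite Csinpi_Re_Im.
assert (Hr : (0 <= r)%R) by apply Cmod_ge_0.
assert (Hx : (Rabs x <= r)%R) by exact (re_le_Cmod (x, y)).
assert (Hy : (Rabs y <= r)%R) by exact (Im_le_Cmod (x, y)).
set (b := (PI * x)%R); set (a := (PI * y)%R); set (p := (PI * r)%R).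
assert (Hb : (Rabs b <= p)%R)
  by (unfold b, p; rewrite Rabs_mult, (Rabs_pos_eq PI) by lra; nra).
assert (Ha : (Rabs a <= p)%R)
  by (unfold a, p; rewrite Rabs_mult, (Rabs_pos_eq PI) by lra; nra).
assert (Hp : (0 <= p <= PI)%R) by (unfold p; nra).
assert (HaPI : (Rabs a <= PI)%R) by lra.
assert (Hch := cosh_le PI a HaPI).
assert (Hsh := Rabs_sinh_le PI a HaPI).
assert (Hch1 := Rabs_cosh_minus_1_le PI a HaPI).
assert (Hsh1 := Rabs_sinh_minus_id_le PI a HaPI).
assert (Hs1 := Rabs_sin_minus_id_le b); assert (Hc1 := Rabs_cos_minus_1_le b).
fold E in Hch, Hsh, Hch1, Hsh1.
assert (Ha0 := Rabs_pos a); assert (Hb0 := Rabs_pos b).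
assert (Hbb : (b * b = Rabs b * Rabs b)%R)
  by (rewrite <- Rabs_mult, Rabs_pos_eq by nra; reflexivity).
rewrite Hbb in Hc1.
set (A := Rabs a) in *; set (B := Rabs b) in *.
assert (HAA : (A * A <= p * p)%R) by nra.
assert (HBB : (B * B <= p * p)%R) by nra.
assert (HAAA : (A * A * A <= p * p * p)%R) by (apply Rmult_le_compat; nra).
assert (HBBB : (B * B * B <= p * p * p)%R) by (apply Rmult_le_compat; nra).
assert (HBAA : (B * (A * A) <= p * (p * p))%R) by (apply Rmult_le_compat; nra).
assert (HABB : (A * (B * B) <= p * (p * p))%R) by (apply Rmult_le_compat; nra).
assert (Hp3 : (0 <= p * p * p)%R)
  by (apply Rmult_le_pos; [apply Rmult_le_pos|]; lra).
assert (HR : (Rabs (sin b * cosh a - b) <= 2 * E * (p * p * p))%R).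
{ replace (sin b * cosh a - b)%R
    with ((sin b - b) * cosh a + b * (cosh a - 1))%R by ring.
  eapply Rle_trans; [apply Rabs_triang|].
  rewrite !Rabs_mult, (Rabs_pos_eq (cosh a)) by lra; fold B.
  assert (Rabs (sin b - b) * cosh a <= (p * p * p) * E)%R
    by (apply Rmult_le_compat; try apply Rabs_pos; lra).
  assert (B * Rabs (cosh a - 1) <= B * (E * A * A))%R
    by (apply Rmult_le_compat_l; lra).
  assert (B * (E * A * A) <= E * (p * p * p))%R
    by (replace (B * (E * A * A))%R with (E * (B * (A * A)))%R by ring;
        apply Rmult_le_compat_l; lra).
  lra. }
assert (HI : (Rabs (cos b * sinh a - a) <= 2 * E * (p * p * p))%R).
{ replace (cos b * sinh a - a)%R
    with ((cos b - 1) * sinh a + (sinh a - a))%R by ring.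
  eapply Rle_trans; [apply Rabs_triang|].
  rewrite !Rabs_mult.
  assert (Rabs (cos b - 1) * Rabs (sinh a) <= (B * B / 2) * (E * A))%R
    by (apply Rmult_le_compat; try apply Rabs_pos; lra).
  assert (B * B / 2 * (E * A) <= E * (p * p * p))%R.
  { replace (B * B / 2 * (E * A))%R with (E * (A * (B * B) / 2))%R by field.
    apply Rmult_le_compat_l; lra. }
  assert (E * A * A * A <= E * (p * p * p))%R
    by (replace (E * A * A * A)%R with (E * (A * A * A))%R by ring;
        apply Rmult_le_compat_l; lra).
  lra. }
eapply Rle_trans; [apply Cmod_le_Re_Im|].
replace (Re _) with ((sin b * cosh a - b) * / PI)%R
  by (unfold a, b; simpl; field; lra).
replace (Im _) with ((cos b * sinh a - a) * / PI)%R
  by (unfold a, b; simpl; field; lra).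
rewrite !Rabs_mult, (Rabs_pos_eq (/ PI)) by (left; apply Rinv_0_lt_compat; lra).
rewrite <- Rmult_plus_distr_r.
replace (4 * E * (PI * PI) * (r * r * r))%R
  with ((2 * E * (p * p * p) + 2 * E * (p * p * p)) * / PI)%R
  by (unfold p; field; lra).
apply Rmult_le_compat_r; [left; apply Rinv_0_lt_compat; lra|lra].
Qed.

Definition non_integer (v : C) : Prop := forall n : Z, v + ZtoC n <> 0.

Lemma Cexp_two_pi_i_neq_1 (v : C) :
  non_integer v -> 1 - Cexp (two_pi_i * v) <> 0.
Proof.
intros Hv H.
destruct (Cexp_eq_1 (two_pi_i * v)) as [k Hk].
{ replace (Cexp (two_pi_i * v)) with (1 - (1 - Cexp (two_pi_i * v))) by ring.
  rewrite H; ring. }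
apply (Hv (- k)%Z); rewrite ZtoC_opp.
replace (v + - ZtoC k) with (/ two_pi_i * (two_pi_i * v - two_pi_i * ZtoC k))
  by (field; apply two_pi_i_neq_0).
rewrite Hk; ring.
Qed.

(** The Koebe function; [calW] is its sum over the points [w q^m]. *)
Definition koebe (X : C) : C := X / (1 - X) ^ 2.

Lemma koebe_Csinpi (v : C) :
  non_integer v ->
  two_pi_i ^ 2 * koebe (Cexp (two_pi_i * v)) = 1 / Csinpi v ^ 2 /\ Csinpi v <> 0.
Proof.
intros Hv; assert (H1 := Cexp_two_pi_i_neq_1 v Hv).
assert (H2 := two_pi_i_neq_0).
unfold koebe, Csinpi.
replace (two_pi_i * v) with (two_pi_i * (v / 2) + two_pi_i * (v / 2)) in *
  by (field; apply RtoC_2_neq_0).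
rewrite Cexp_plus in *.
assert (HY := Cexp_neq_0 (two_pi_i * (v / 2))).
set (Y := Cexp (two_pi_i * (v / 2))) in *.
assert (H3 : Y - / Y <> 0).
{ intros H; apply H1; replace (1 - Y * Y) with (- Y * (Y - / Y)) by (field; exact HY).
  rewrite H; ring. }
split.
- field; repeat split; auto.
  intros H; apply H1; rewrite <- Copp_minus_distr, H; ring.
- apply Cmult_neq_0; [exact H3|apply Cinv_neq_0, H2].
Qed.

(** Near [0] the double poles of [(PI / sin (PI v))^2] and of [1 / v^2] cancel
    because [sin] has no quadratic term. *)
Lemma koebe_minus_pole_bounded :
  exists K, forall v, non_integer v -> (Rabs (Re v) <= / 2)%R ->
    (Cmod (two_pi_i ^ 2 * koebe (Cexp (two_pi_i * v)) - 1 / v ^ 2) <= K)%R.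
Proof.
destruct Csinpi_third_order as [C0 [HC0 HC]].
exists (17 + 16 * (C0 * (2 + C0)))%R; intros v Hv Hx.
destruct (koebe_Csinpi v Hv) as [-> HS].
assert (Hv0 : v <> 0).
{ intros H; apply (Hv 0%Z); unfold ZtoC; rewrite H; ring. }
assert (Hge := Cmod_Csinpi_ge v Hx).
assert (Hr : (0 < Cmod v)%R) by (apply Cmod_gt_0; exact Hv0).
assert (Ht : (0 < Cmod (Csinpi v))%R) by lra.
set (S := Csinpi v) in *; set (r := Cmod v) in *.
assert (Hinv : forall z : C, z <> 0 -> Cmod (1 / z ^ 2) = (/ (Cmod z * Cmod z))%R).
{ intros z Hz; rewrite Cmod_div, Cmod_1, Cmod_pow by (apply Cpow_nz, Hz).
  simpl; rewrite Rmult_1_r; unfold Rdiv; ring. }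
assert (Hpos : (0 <= 16 * (C0 * (2 + C0)))%R) by nra.
destruct (Rle_lt_dec 1 r) as [H1|H1].
- eapply Rle_trans; [apply Cmod_minus_le|].
  rewrite !Hinv by assumption; fold r.
  assert (HA : (/ (Cmod S * Cmod S) <= 16)%R).
  { replace 16%R with (/ (/ 4 * / 4))%R by field.
    apply Rinv_le_contravar; nra. }
  assert (HB : (/ (r * r) <= 1)%R).
  { rewrite <- Rinv_1; apply Rinv_le_contravar; nra. }
  lra.
- specialize (HC v ltac:(unfold r in H1; lra)); fold S r in HC.
  replace (1 / S ^ 2 - 1 / v ^ 2)
    with (- ((S - v) * (S - v + 2 * v)) * (1 / S ^ 2 * (1 / v ^ 2)))
    by (field; split; assumption).
  rewrite !Cmod_mult, Cmod_opp, !Hinv, Cmod_mult by assumption; fold r.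
  assert (HA : (/ (Cmod S * Cmod S) <= 16 * / (r * r))%R).
  { replace (16 * / (r * r))%R with (/ (r / 4 * (r / 4)))%R by (field; lra).
    apply Rinv_le_contravar; nra. }
  assert (HB : (Cmod (S - v + 2 * v) <= (2 + C0) * r)%R).
  { eapply Rle_trans; [apply Cmod_triangle|].
    rewrite Cmod_mult, Cmod_R, Rabs_pos_eq by lra; fold r.
    assert (Hrr : (r * r * r <= r)%R) by nra.
    assert (C0 * (r * r * r) <= C0 * r)%R by (apply Rmult_le_compat_l; lra).
    lra. }
  assert (HD : (Cmod (S - v) * Cmod (S - v + 2 * v)
                 <= C0 * (r * r * r) * ((2 + C0) * r))%R)
    by (apply Rmult_le_compat; try apply Cmod_ge_0; assumption).
  assert (Hi : (0 < / (r * r))%R) by (apply Rinv_0_lt_compat; nra).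
  assert (Hi2 : (0 < / (Cmod S * Cmod S))%R) by (apply Rinv_0_lt_compat; nra).
  eapply Rle_trans.
  { apply Rmult_le_compat; [| |exact HD|].
    - apply Rmult_le_pos; apply Cmod_ge_0.
    - apply Rmult_le_pos; lra.
    - apply Rmult_le_compat_r; [lra|exact HA]. }
  replace (C0 * (r * r * r) * ((2 + C0) * r) * (16 * / (r * r) * / (r * r)))%R
    with (16 * (C0 * (2 + C0)))%R by (field; lra).
  lra.
Qed.

Lemma strip_distance (v : C) (n : Z) :
  (Rabs (Re v) <= / 2)%R -> n <> 0%Z ->
  (INR (S (Z.abs_nat n)) / 4 <= Cmod (v + ZtoC n))%R.
Proof.
intros Hv Hn.
eapply Rle_trans; [|apply re_le_Cmod].
assert (HR : Re (v + ZtoC n) = (Re v + IZR n)%R)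
  by (destruct v; reflexivity).
rewrite HR, S_INR, INR_IZR_INZ, Zabs2Nat.id_abs.
assert (Ha : (Rabs (IZR n) = IZR (Z.abs n))%R) by (rewrite abs_IZR; reflexivity).
assert (H1 : (1 <= IZR (Z.abs n))%R) by (apply IZR_le; lia).
assert (H := Rabs_triang_inv (IZR n) (- Re v)).
rewrite Rabs_Ropp, Ha in H.
replace (IZR n - - Re v)%R with (Re v + IZR n)%R in H by ring; lra.
Qed.

Definition inv_square_shift (v : C) (n : Z) : C := 1 / (v + ZtoC n) ^ 2.

Lemma strip_sum (v : C) :
  non_integer v -> (Rabs (Re v) <= / 2)%R ->
  exists s, is_sum_over (inv_square_shift v) s /\ (Cmod (s - 1 / v ^ 2) <= 96)%R.
Proof.
intros Hv Hx.
set (g := fun n : Z => if Z.eq_dec n 0 then RtoC 0 else inv_square_shift v n).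
assert (Hg : bounded_sums g 96).
{ replace 96%R with (16 * 6)%R by ring; apply bounded_sums_weight; intros n.
  unfold g; destruct (Z.eq_dec n 0) as [->|Hn].
  - rewrite Cmod_0; assert (H := weight_pos 0); lra.
  - unfold inv_square_shift.
    rewrite Cmod_div, Cmod_1, Cmod_pow by (apply Cpow_nz, Hv).
    assert (H := strip_distance v n Hx Hn).
    set (j := INR (S (Z.abs_nat n))) in *.
    assert (Hj : (0 < j)%R) by (apply lt_0_INR; lia).
    apply Rle_trans with (16 * / (j * j))%R.
    + replace (16 * / (j * j))%R with (/ (j / 4 * (j / 4)))%R by (field; lra).
      unfold Rdiv at 1; rewrite Rmult_1_l.
      apply Rinv_le_contravar; [nra|simpl; nra].
    + apply Rmult_le_compat_l; [lra|].
      apply weight_of_square_le, Rle_refl. }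
destruct (bounded_sums_is_sum g 96 Hg) as [s Hs].
assert (Hs0 := Cmod_is_sum_le g 96 s Hg Hs).
exists (s + 1 / v ^ 2); split.
- apply is_sum_over_ext with
    (fun n => g n + (if Z.eq_dec n 0 then 1 / v ^ 2 else 0)).
  + intros n; unfold g; destruct (Z.eq_dec n 0) as [->|Hn]; [|ring].
    unfold inv_square_shift, ZtoC; rewrite Cplus_0_r; ring.
  + apply is_sum_over_plus; [exact Hs|].
    apply (is_sum_over_single (fun n : Z => if Z.eq_dec n 0 then 1 / v ^ 2 else 0) 0%Z).
    intros n Hn; destruct (Z.eq_dec n 0); [contradiction|reflexivity].
- replace (s + 1 / v ^ 2 - 1 / v ^ 2) with s by ring; exact Hs0.
Qed.

Lemma exists_strip_shift (v : C) :
  exists k : Z, (Rabs (Re (v + ZtoC k)) <= / 2)%R.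
Proof.
(* [up x] lies in (x, x + 1]. *)
exists (- (up (Re v - / 2)))%Z.
assert (H := archimed (Re v - / 2)).
assert (HR : Re (v + ZtoC (- up (Re v - / 2))) = (Re v - IZR (up (Re v - / 2)))%R)
  by (destruct v; unfold ZtoC; rewrite opp_IZR; reflexivity).
rewrite HR; apply Rabs_le; lra.
Qed.

(** Both sides have period [1], so it suffices to bound their difference on the
    strip [|Re v| <= 1/2], where every term of the series other than the one at
    the pole [0] is dominated by a fixed weight. *)
Lemma Herglotz_bounded :
  exists M, forall v, non_integer v -> exists s,
    is_sum_over (inv_square_shift v) s /\
    (Cmod (two_pi_i ^ 2 * koebe (Cexp (two_pi_i * v)) - s) <= M)%R.
Proof.
destruct koebe_minus_pole_bounded as [K HK].
exists (K + 96)%R; intros v Hv.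
destruct (exists_strip_shift v) as [k Hk].
assert (Hvk : non_integer (v + ZtoC k)).
{ intros n; rewrite <- Cplus_assoc, <- ZtoC_plus; apply Hv. }
destruct (strip_sum _ Hvk Hk) as [s [Hs Hs']].
exists s; split.
- apply is_sum_over_ext with (fun n => inv_square_shift (v + ZtoC k) (n - k)).
  + intros n; unfold inv_square_shift.
    rewrite <- Cplus_assoc, <- ZtoC_plus; do 4 f_equal; ring.
  + apply (is_sum_over_reindex (fun n => n - k)%Z (fun n => n + k)%Z);
      [intros; ring..|exact Hs].
- specialize (HK _ Hvk Hk).
  replace (two_pi_i * (v + ZtoC k)) with (two_pi_i * v + two_pi_i * ZtoC k)
    in HK by ring.
  rewrite Cexp_plus, Cexp_two_pi_i_Z, Cmult_1_r in HK.
  replace (_ - s) with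
    ((two_pi_i ^ 2 * koebe (Cexp (two_pi_i * v)) - 1 / (v + ZtoC k) ^ 2)
     - (s - 1 / (v + ZtoC k) ^ 2)) by ring.
  eapply Rle_trans; [apply Cmod_minus_le|]; lra.
Qed.

(** For [Y = exp (PI i v)] this is the duplication formula of [(PI / sin (PI
    v))^2]: passing from [v / 2] to [(v + 1) / 2] changes the sign of [Y]. *)
Lemma koebe_duplication (Y : C) :
  1 - Y <> 0 -> 1 + Y <> 0 -> koebe Y + koebe (- Y) = 4 * koebe (Y * Y).
Proof.
intros H1 H2; unfold koebe; field; repeat split; auto.
- replace (1 - Y * Y) with ((1 - Y) * (1 + Y)) by ring.
  apply Cmult_neq_0; assumption.
- replace (1 - - Y) with (1 + Y) by ring; exact H2.
Qed.

(** Herglotz' argument: the difference [h] of [(PI / sin (PI v))^2] and of its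
    partial fraction series is bounded and satisfies
    [4 h v = h (v / 2) + h ((v + 1) / 2)], so that its bound can be halved
    indefinitely. *)
Lemma Herglotz (v : C) :
  non_integer v ->
  is_sum_over (inv_square_shift v)
    (two_pi_i ^ 2 * koebe (Cexp (two_pi_i * v))).
Proof.
intros Hv.
destruct Herglotz_bounded as [M HM].
assert (Hind : forall (N : nat) v s, non_integer v ->
  is_sum_over (inv_square_shift v) s ->
  (Cmod (two_pi_i ^ 2 * koebe (Cexp (two_pi_i * v)) - s) <= M * (/ 2) ^ N)%R).
{ clear v Hv; induction N as [|N IH]; intros v s Hv Hs.
  - destruct (HM v Hv) as [s' [Hs' HB]].
    rewrite (is_sum_over_unique _ _ _ Hs Hs'); rewrite pow_O, Rmult_1_r; exact HB.
  - assert (H2 := RtoC_2_neq_0).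
    assert (Z1 : ZtoC 1 = 1) by reflexivity.
    assert (Z2 : ZtoC 2 = 2) by reflexivity.
    assert (E0 : forall n, v / 2 + ZtoC n = (v + ZtoC (2 * n)) / 2).
    { intros n; rewrite ZtoC_mult, Z2; field; exact H2. }
    assert (E1 : forall n, (v + 1) / 2 + ZtoC n = (v + ZtoC (2 * n + 1)) / 2).
    { intros n; rewrite ZtoC_plus, ZtoC_mult, Z1, Z2; field; exact H2. }
    assert (Hv0 : non_integer (v / 2)).
    { intros n; rewrite E0; apply Cmult_neq_0; [apply Hv|apply Cinv_neq_0, H2]. }
    assert (Hv1 : non_integer ((v + 1) / 2)).
    { intros n; rewrite E1; apply Cmult_neq_0; [apply Hv|apply Cinv_neq_0, H2]. }
    destruct (HM _ Hv0) as [s0 [Hs0 _]]; destruct (HM _ Hv1) as [s1 [Hs1 _]].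
    assert (Hsum : s = / 4 * s0 + / 4 * s1).
    { assert (H4 : RtoC 4 <> 0) by (intros H; apply RtoC_inj in H; lra).
      apply (is_sum_over_even_odd _ _ _ _ Hs).
      - apply is_sum_over_ext with (fun n => / 4 * inv_square_shift (v / 2) n).
        + intros n; unfold inv_square_shift; rewrite E0.
          field; repeat split; auto.
        + apply is_sum_over_scal, Hs0.
      - apply is_sum_over_ext with
          (fun n => / 4 * inv_square_shift ((v + 1) / 2) n).
        + intros n; unfold inv_square_shift; rewrite E1.
          field; repeat split; auto.
        + apply is_sum_over_scal, Hs1. }
    assert (HY1 := Cexp_two_pi_i_neq_1 _ Hv0).
    assert (HY2 := Cexp_two_pi_i_neq_1 _ Hv1).
    assert (B0 := IH _ _ Hv0 Hs0); assert (B1 := IH _ _ Hv1 Hs1).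
    set (Y := Cexp (two_pi_i * (v / 2))) in *.
    assert (EY : Cexp (two_pi_i * ((v + 1) / 2)) = - Y).
    { replace (two_pi_i * ((v + 1) / 2)) with (two_pi_i * (v / 2) + two_pi_i / 2)
        by (field; exact H2).
      rewrite Cexp_plus; fold Y.
      replace (Cexp (two_pi_i / 2)) with (- (1)); [ring|].
      replace (two_pi_i / 2) with (0, PI)
        by (rewrite two_pi_i_eq; apply injective_projections; simpl; field).
      unfold Cexp; simpl; rewrite exp_0, cos_PI, sin_PI.
      apply injective_projections; simpl; ring. }
    rewrite EY in *.
    assert (EX : Cexp (two_pi_i * v) = Y * Y).
    { unfold Y; rewrite <- Cexp_plus; f_equal; field; exact H2. }
    assert (D := koebe_duplication Y HY1 ltac:(intros H; apply HY2; rewrite <- H; ring)).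
    rewrite EX, Hsum.
    replace (two_pi_i ^ 2 * koebe (Y * Y) - (/ 4 * s0 + / 4 * s1))
      with (/ 4 * ((two_pi_i ^ 2 * koebe Y - s0) + (two_pi_i ^ 2 * koebe (- Y) - s1))).
    2:{ transitivity (/ 4 * (two_pi_i ^ 2 * (koebe Y + koebe (- Y)) - s0 - s1));
          [ring|rewrite D; field]. }
    rewrite Cmod_mult, <- RtoC_inv, Cmod_R, Rabs_pos_eq by lra.
    assert (HT := Cmod_triangle (two_pi_i ^ 2 * koebe Y - s0)
                    (two_pi_i ^ 2 * koebe (- Y) - s1)).
    simpl pow; lra. }
destruct (HM v Hv) as [s [Hs _]].
replace (two_pi_i ^ 2 * koebe (Cexp (two_pi_i * v))) with s; [exact Hs|].
set (d := two_pi_i ^ 2 * koebe (Cexp (two_pi_i * v)) - s).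
assert (Hd : Cmod d = 0%R).
{ apply Rle_antisym; [|apply Cmod_ge_0].
  apply (is_lim_seq_le (fun _ => Cmod d) (fun N => M * (/ 2) ^ N)%R
           (Cmod d) 0%R).
  - intros N; apply (Hind N v s Hv Hs).
  - apply is_lim_seq_const.
  - replace (Finite 0) with (Rbar_mult M 0) by (simpl; f_equal; ring).
    apply is_lim_seq_scal_l, is_lim_seq_geom.
    rewrite Rabs_pos_eq; lra. }
apply Cmod_eq_0 in Hd; unfold d in Hd.
replace s with (two_pi_i ^ 2 * koebe (Cexp (two_pi_i * v))
  - (two_pi_i ^ 2 * koebe (Cexp (two_pi_i * v)) - s)) by ring.
rewrite Hd; ring.
Qed.

(** * Termwise differentiation of the [q]-series *)

Lemma Cpowz_plus (q : C) (m n : Z) :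
  q <> 0 -> Cpowz q (m + n) = Cpowz q m * Cpowz q n.
Proof.
intros Hq; destruct (Cexp_surj q Hq) as [c <-].
rewrite !Cpowz_Cexp, <- Cexp_plus, ZtoC_plus; f_equal; ring.
Qed.

Lemma Cpowz_neq_0 (q : C) (m : Z) : q <> 0 -> Cpowz q m <> 0.
Proof.
intros Hq; destruct (Cexp_surj q Hq) as [c <-].
rewrite Cpowz_Cexp; apply Cexp_neq_0.
Qed.

Lemma Cmod_Cpowz (q : C) (m : Z) :
  q <> 0 ->
  Cmod (Cpowz q m) =
  if Z_le_gt_dec 0 m then (Cmod q ^ Z.abs_nat m)%R
  else (/ Cmod q ^ Z.abs_nat m)%R.
Proof.
intros Hq; destruct m as [|p|p]; simpl Cpowz.
- simpl; apply Cmod_1.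
- simpl; apply Cmod_pow.
- simpl; rewrite Cmod_inv, Cmod_pow by (apply Cpow_nz, Hq); reflexivity.
Qed.

(** [X * d/dX] of [koebe]. *)
Definition theta_koebe (X : C) : C := X * (1 + X) / (1 - X) ^ 3.

(** The pole of index [m0] is permitted, so that a neighbourhood of any [w0]
    can be treated in the same way, be [w0] a pole or not. *)
Definition avoids_poles (q : C) (m0 : Z) (w : C) : Prop :=
  forall m, m <> m0 -> 1 - w * Cpowz q m <> 0.

(** The term of index [m0] is set to zero, so that the sum remains regular at
    the pole [w q^m0 = 1]. *)
Definition punctured (F : C -> C) (q : C) (m0 : Z) (w : C) (m : Z) : C :=
  if Z.eq_dec m m0 then 0 else F (w * Cpowz q m).

(** [1 - w0 q^m] tends to [1] as [m] grows and is comparable to [w0 q^m] as [m]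
    decreases; finitely many indices remain. *)
Lemma poles_distance (q : C) (m0 : Z) (w0 : C) :
  q <> 0 -> (Cmod q < 1)%R -> w0 <> 0 -> avoids_poles q m0 w0 ->
  exists d, (0 < d)%R /\ forall m, m <> m0 ->
    (d <= Cmod (1 - w0 * Cpowz q m))%R /\
    (d * Cmod (Cpowz q m) <= Cmod (1 - w0 * Cpowz q m))%R.
Proof.
intros Hq Hq1 Hw0 Hav.
assert (Hs : (0 < Cmod q)%R) by (apply Cmod_gt_0, Hq).
assert (Hr : (0 < Cmod w0)%R) by (apply Cmod_gt_0, Hw0).
set (s := Cmod q) in *; set (r := Cmod w0) in *.
destruct (pow_lt_1_zero s ltac:(rewrite Rabs_pos_eq; lra)
  (Rmin (/ (2 * r)) (r / 2))) as [N HN].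
{ apply Rmin_case; [apply Rinv_0_lt_compat; lra|lra]. }
set (l := Zrange N).
destruct (finite_positive_lower_bound
  (fun m => Cmod (1 - w0 * Cpowz q m)) l) as [d1 [Hd1 H1]].
destruct (finite_positive_lower_bound
  (fun m => Cmod (1 - w0 * Cpowz q m) / Cmod (Cpowz q m))%R l)
  as [d2 [Hd2 H2]].
set (d := Rmin (Rmin d1 d2) (Rmin (/ 2) (r / 2))).
assert (Hd : (0 < d)%R) by (unfold d; repeat apply Rmin_case; lra).
assert (Hdd1 : (d <= d1)%R)
  by (unfold d; eapply Rle_trans; [apply Rmin_l|apply Rmin_l]).
assert (Hdd2 : (d <= d2)%R)
  by (unfold d; eapply Rle_trans; [apply Rmin_l|apply Rmin_r]).
assert (Hdh : (d <= / 2)%R)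
  by (unfold d; eapply Rle_trans; [apply Rmin_r|apply Rmin_l]).
assert (Hdr : (d <= r / 2)%R)
  by (unfold d; eapply Rle_trans; [apply Rmin_r|apply Rmin_r]).
clearbody d.
exists d; split; [exact Hd|]; intros m Hm.
assert (Hpos : (0 < Cmod (1 - w0 * Cpowz q m))%R) by (apply Cmod_gt_0, Hav, Hm).
assert (Hc : (0 < Cmod (Cpowz q m))%R) by (apply Cmod_gt_0, Cpowz_neq_0, Hq).
destruct (le_lt_dec N (Z.abs_nat m)) as [HNm|HNm].
- specialize (HN _ HNm).
  assert (Hsm : (0 < s ^ Z.abs_nat m)%R) by (apply pow_lt, Hs).
  rewrite Rabs_pos_eq in HN by lra.
  assert (HN1 := Rlt_le_trans _ _ _ HN (Rmin_l _ _)).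
  assert (HN2 := Rlt_le_trans _ _ _ HN (Rmin_r _ _)).
  assert (Hmod := Cmod_Cpowz q m Hq); fold s in Hmod.
  set (c := Cpowz q m) in *; set (x := (s ^ Z.abs_nat m)%R) in *.
  assert (Hwc : Cmod (w0 * c) = (r * Cmod c)%R) by apply Cmod_mult.
  destruct (Z_le_gt_dec 0 m).
  + (* Here [|w0 q^m| <= 1/2]. *)
    assert (Hx : (r * x <= / 2)%R).
    { replace (/ 2)%R with (r * / (2 * r))%R by (field; lra).
      apply Rmult_le_compat_l; lra. }
    assert (Hge : (/ 2 <= Cmod (1 - w0 * c))%R).
    { eapply Rle_trans; [|apply Cmod_minus_ge]; rewrite Cmod_1, Hwc, Hmod; lra. }
    assert (Hx1 : (x <= 1)%R).
    { unfold x; rewrite <- (pow1 (Z.abs_nat m)); apply pow_incr; lra. }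
    rewrite Hmod; nra.
  + (* Here [|w0 q^m| >= 2]. *)
    assert (Hge : (r * Cmod c / 2 <= Cmod (1 - w0 * c))%R).
    { rewrite Cmod_minus_sym; eapply Rle_trans; [|apply Cmod_minus_ge].
      rewrite Cmod_1, Hwc.
      assert (2 <= r * Cmod c)%R; [|lra].
      rewrite Hmod; apply Rmult_le_reg_r with x; [lra|].
      rewrite Rmult_assoc, Rinv_l by lra; lra. }
    assert (Hc1 : (1 <= r * Cmod c / 2)%R).
    { rewrite Hmod; apply Rmult_le_reg_r with x; [lra|].
      replace (r * / x / 2 * x)%R with (r / 2)%R by (field; lra); lra. }
    split; [lra|]; nra.
- assert (Hl : In m l) by (apply In_Zrange, HNm).
  specialize (H1 m Hl Hpos).
  specialize (H2 m Hl ltac:(apply Rdiv_lt_0_compat; assumption)).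
  split; [lra|].
  apply Rle_trans with (d2 * Cmod (Cpowz q m))%R.
  + apply Rmult_le_compat_r; lra.
  + apply Rmult_le_reg_r with (/ Cmod (Cpowz q m))%R;
      [apply Rinv_0_lt_compat, Hc|].
    rewrite Rmult_assoc, Rinv_r, Rmult_1_r by lra; exact H2.
Qed.

(** Uniformly for [w] near [w0], both [1 / (1 - w q^m)] and
    [q^m / (1 - w q^m)] are bounded: the former controls the terms with
    [m >= 0], the latter those with [m < 0]. *)
Lemma resolvent_bound (q : C) (m0 : Z) (w0 : C) :
  q <> 0 -> (Cmod q < 1)%R -> w0 <> 0 -> avoids_poles q m0 w0 ->
  exists (d : posreal) (K : R), (1 <= K)%R /\
    forall w, (Cmod (w - w0) < d)%R -> w <> 0 /\ forall m, m <> m0 ->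
      1 - w * Cpowz q m <> 0 /\
      (Cmod (/ (1 - w * Cpowz q m)) <= K)%R /\
      (Cmod (Cpowz q m * / (1 - w * Cpowz q m)) <= K)%R.
Proof.
intros Hq Hq1 Hw0 Hav.
destruct (poles_distance q m0 w0 Hq Hq1 Hw0 Hav) as [d [Hd H]].
assert (Hr : (0 < Cmod w0)%R) by (apply Cmod_gt_0, Hw0).
assert (He : (0 < Rmin (d / 2) (Cmod w0))%R) by (apply Rmin_case; lra).
exists (mkposreal _ He), (2 / d + 1)%R; simpl pos.
assert (HK : (0 < 2 / d)%R) by (apply Rdiv_lt_0_compat; lra).
split; [lra|]; intros w Hw.
assert (Hw1 := Rlt_le_trans _ _ _ Hw (Rmin_l _ _)).
assert (Hw2 := Rlt_le_trans _ _ _ Hw (Rmin_r _ _)).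
split.
{ intros E; rewrite E, Cmod_minus_sym in Hw2.
  replace (w0 - 0) with w0 in Hw2 by ring; lra. }
intros m Hm; destruct (H m Hm) as [H1 H2].
set (c := Cpowz q m) in *.
assert (Hc0 : (0 <= Cmod c)%R) by apply Cmod_ge_0.
assert (Hge : (Cmod (1 - w0 * c) / 2 <= Cmod (1 - w * c))%R).
{ replace (1 - w * c) with ((1 - w0 * c) - (w - w0) * c) by ring.
  eapply Rle_trans; [|apply Cmod_minus_ge]; rewrite Cmod_mult.
  assert (Cmod (w - w0) * Cmod c <= d / 2 * Cmod c)%R
    by (apply Rmult_le_compat_r; lra).
  lra. }
assert (Hpos : (0 < Cmod (1 - w * c))%R) by lra.
assert (Hnz : 1 - w * c <> 0) by (apply Cmod_gt_0, Hpos).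
split; [exact Hnz|]; rewrite Cmod_mult, Cmod_inv by exact Hnz.
set (b := Cmod (1 - w * c)) in *.
assert (Hb : forall t, (0 <= t)%R -> (d * t <= 2 * b)%R ->
               (t * / b <= 2 / d + 1)%R).
{ intros t Ht Htb; apply Rle_trans with (2 / d)%R; [|lra].
  apply Rmult_le_reg_r with (d * b)%R; [apply Rmult_lt_0_compat; lra|].
  replace (t * / b * (d * b))%R with (d * t)%R by (field; lra).
  replace (2 / d * (d * b))%R with (2 * b)%R by (field; lra); exact Htb. }
split.
- rewrite <- (Rmult_1_l (/ b)); apply Hb; lra.
- apply Hb; lra.
Qed.

(** For [m >= 0] the factor [q^m] is itself small; for [m < 0] the product is
    [(q^m x) (q^m y) q^(-m)]. *)
Lemma Cpowz_weight2 (q x y : C) (m : Z) (K : R) :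
  q <> 0 -> (Cmod q < 1)%R ->
  (Cmod x <= K)%R -> (Cmod (Cpowz q m * x) <= K)%R ->
  (Cmod y <= K)%R -> (Cmod (Cpowz q m * y) <= K)%R ->
  (Cmod (Cpowz q m * x * y) <= K * K * Cmod q ^ Z.abs_nat m)%R.
Proof.
intros Hq Hq1 Hx Hcx Hy Hcy.
assert (Hs : (0 < Cmod q)%R) by (apply Cmod_gt_0, Hq).
assert (Ht : (0 < Cmod q ^ Z.abs_nat m)%R) by (apply pow_lt, Hs).
assert (Hmod := Cmod_Cpowz q m Hq).
rewrite Cmod_mult in Hcx, Hcy; rewrite !Cmod_mult.
assert (Hx0 := Cmod_ge_0 x); assert (Hy0 := Cmod_ge_0 y).
assert (Hc0 := Cmod_ge_0 (Cpowz q m)).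
set (c := Cmod (Cpowz q m)) in *; set (t := (Cmod q ^ Z.abs_nat m)%R) in *.
destruct (Z_le_gt_dec 0 m).
- rewrite Hmod; rewrite Rmult_assoc, Rmult_comm.
  apply Rmult_le_compat_r; [lra|]; apply Rmult_le_compat; lra.
- assert (Hct : (c * t = 1)%R) by (rewrite Hmod; field; lra).
  replace (c * Cmod x * Cmod y)%R with (c * Cmod x * (c * Cmod y) * t)%R
    by (transitivity (c * Cmod x * Cmod y * (c * t))%R; [|rewrite Hct]; ring).
  apply Rmult_le_compat_r; [lra|]; apply Rmult_le_compat; try lra;
    apply Rmult_le_pos; assumption.
Qed.

Lemma Cpowz_weight3 (q x y z : C) (m : Z) (K : R) :
  q <> 0 -> (Cmod q < 1)%R ->
  (Cmod x <= K)%R -> (Cmod (Cpowz q m * x) <= K)%R ->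
  (Cmod y <= K)%R -> (Cmod (Cpowz q m * y) <= K)%R ->
  (Cmod z <= K)%R -> (Cmod (Cpowz q m * z) <= K)%R ->
  (Cmod (Cpowz q m * Cpowz q m * x * y * z)
    <= K * K * K * Cmod q ^ Z.abs_nat m)%R.
Proof.
intros Hq Hq1 Hx Hcx Hy Hcy Hz Hcz.
replace (Cpowz q m * Cpowz q m * x * y * z)
  with ((Cpowz q m * x * y) * (Cpowz q m * z)) by ring.
rewrite Cmod_mult.
assert (H := Cpowz_weight2 q x y m K Hq Hq1 Hx Hcx Hy Hcy).
replace (K * K * K * Cmod q ^ Z.abs_nat m)%R
  with (K * K * Cmod q ^ Z.abs_nat m * K)%R by ring.
apply Rmult_le_compat; try apply Cmod_ge_0; assumption.
Qed.

(** The hypothesis on [F] says that [F X], as a rational function of [X],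
    vanishes both at [0] and at infinity; this is what makes a two-sided series
    in [q^m] converge. *)
Lemma punctured_bounded (F G : C -> C) (q : C) (m0 : Z) (w : C) :
  q <> 0 -> (Cmod q < 1)%R -> w <> 0 -> avoids_poles q m0 w ->
  (forall c, 1 - w * c <> 0 ->
     F (w * c) = c * / (1 - w * c) * / (1 - w * c) * G (/ (1 - w * c))) ->
  (forall K, (1 <= K)%R -> exists B, forall x, (Cmod x <= K)%R -> (Cmod (G x) <= B)%R) ->
  exists B, bounded_sums (punctured F q m0 w) B.
Proof.
intros Hq Hq1 Hw Hav HF HG.
destruct (resolvent_bound q m0 w Hq Hq1 Hw Hav) as [d [K [HK H]]].
destruct (HG K HK) as [B HB].
assert (HB0 : (0 <= B)%R).
{ assert (H0 := HB 0 ltac:(rewrite Cmod_0; lra)).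
  assert (H1 := Cmod_ge_0 (G 0)); lra. }
destruct (H w) as [_ Hm].
{ replace (w - w) with (RtoC 0) by ring; rewrite Cmod_0; apply cond_pos. }
eexists; apply (bounded_sums_geometric _ (B * (K * K))%R (Cmod q)).
{ split; [apply Cmod_ge_0|exact Hq1]. }
intros m; unfold punctured; destruct (Z.eq_dec m m0) as [_|Hmm].
- rewrite Cmod_0; apply Rmult_le_pos; [nra|apply pow_le, Cmod_ge_0].
- destruct (Hm m Hmm) as [H1 [H2 H3]]; rewrite HF, Cmod_mult by exact H1.
  rewrite Rmult_comm, Rmult_assoc.
  apply Rmult_le_compat; try apply Cmod_ge_0; [apply HB, H2|].
  apply Cpowz_weight2; assumption.
Qed.

(** The quadratic remainders of the terms, majorized by a convergent series,
    add up to a quadratic remainder of the sum. *)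
Lemma is_C_derive_sum {I : Type} (f : I -> C -> C) (f' : I -> C) (F : C -> C)
    (z l : C) (d : posreal) (M : I -> R) (B : R) :
  (forall w, (Cmod (w - z) < d)%R -> is_sum_over (fun i => f i w) (F w)) ->
  is_sum_over f' l ->
  (forall G, NoDup G -> rsum M G <= B)%R ->
  (forall i w, (Cmod (w - z) < d)%R ->
    (Cmod (f i w - f i z - (w - z) * f' i)
      <= M i * (Cmod (w - z) * Cmod (w - z)))%R) ->
  is_derive F z l.
Proof.
intros HF Hl HM Hf.
apply (is_C_derive_square F z l d B); intros w Hw.
assert (Hz : is_sum_over (fun i => f i z) (F z)).
{ apply HF; replace (z - z) with (RtoC 0) by ring; rewrite Cmod_0; apply cond_pos. }
assert (Hs := is_sum_over_minus _ _ _ _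
  (is_sum_over_minus _ _ _ _ (HF w Hw) Hz) (is_sum_over_scal (w - z) _ _ Hl)).
refine (Cmod_is_sum_le _ _ _ _ Hs).
apply (bounded_sums_le _
  (fun i => (Cmod (w - z) * Cmod (w - z)) * M i)%R).
- intros i; rewrite Rmult_comm; apply Hf, Hw.
- intros G Hd; rewrite rsum_scal, Rmult_comm; apply Rmult_le_compat_r;
    [apply Rmult_le_pos; apply Cmod_ge_0|apply HM, Hd].
Qed.

Lemma is_sum_over_sum_over {I : Type} (f : I -> C) (B : R) :
  bounded_sums f B -> is_sum_over f (sum_over f).
Proof.
intros HB; destruct (bounded_sums_is_sum f B HB) as [s Hs].
rewrite (sum_over_eq f s Hs); exact Hs.
Qed.

Lemma punctured_koebe_is_sum (q : C) (m0 : Z) (w : C) :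
  q <> 0 -> (Cmod q < 1)%R -> w <> 0 -> avoids_poles q m0 w ->
  is_sum_over (punctured koebe q m0 w) (sum_over (punctured koebe q m0 w)).
Proof.
intros Hq Hq1 Hw Hav.
destruct (punctured_bounded koebe (fun _ => w) q m0 w Hq Hq1 Hw Hav) as [B HB].
- intros c Hc; unfold koebe; field; exact Hc.
- intros K _; exists (Cmod w); intros; lra.
- exact (is_sum_over_sum_over _ B HB).
Qed.

Lemma punctured_theta_koebe_is_sum (q : C) (m0 : Z) (w : C) :
  q <> 0 -> (Cmod q < 1)%R -> w <> 0 -> avoids_poles q m0 w ->
  is_sum_over (punctured theta_koebe q m0 w)
    (sum_over (punctured theta_koebe q m0 w)).
Proof.
intros Hq Hq1 Hw Hav.
destruct (punctured_bounded theta_koebe (fun x => w * (2 * x - 1)) q m0 w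
  Hq Hq1 Hw Hav) as [B HB].
- intros c Hc; unfold theta_koebe; field; exact Hc.
- intros K HK; exists (Cmod w * (2 * K + 1))%R; intros x Hx.
  rewrite Cmod_mult; apply Rmult_le_compat_l; [apply Cmod_ge_0|].
  eapply Rle_trans; [apply Cmod_minus_le|].
  rewrite Cmod_mult, Cmod_R, Cmod_1, Rabs_pos_eq by lra; lra.
- exact (is_sum_over_sum_over _ B HB).
Qed.

(** The remainder of [F] at first order is assumed to contain [(q^m)^2] and
    three inverse factors [1 - w q^m], which by [Cpowz_weight3] gives geometric
    decay in both directions.  When [F] is a polynomial in [1 / (1 - X)], such
    a [Q] is found by polynomial division. *)
Lemma is_C_derive_punctured (F : C -> C) (Q : C -> C -> C) (F' : C -> C)
    (q : C) (m0 : Z) (w0 l : C) :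
  q <> 0 -> (Cmod q < 1)%R -> w0 <> 0 -> avoids_poles q m0 w0 ->
  (forall w : C, w <> 0 -> avoids_poles q m0 w ->
     is_sum_over (punctured F q m0 w) (sum_over (punctured F q m0 w))) ->
  is_sum_over (punctured (fun X => / w0 * F' X) q m0 w0) l ->
  (forall w c, 1 - w0 * c <> 0 -> 1 - w * c <> 0 ->
     F (w * c) - F (w0 * c) - (w - w0) * (/ w0 * F' (w0 * c)) =
     (w - w0) * (w - w0) *
       (c * c * / (1 - w0 * c) * / (1 - w0 * c) * / (1 - w * c)) *
       Q (/ (1 - w0 * c)) (/ (1 - w * c))) ->
  (forall K, (1 <= K)%R -> exists B, forall x y,
     (Cmod x <= K)%R -> (Cmod y <= K)%R -> (Cmod (Q x y) <= B)%R) ->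
  is_derive (fun w => sum_over (punctured F q m0 w)) w0 l.
Proof.
intros Hq Hq1 Hw0 Hav Hsum Hl HF HQ.
destruct (resolvent_bound q m0 w0 Hq Hq1 Hw0 Hav) as [d [K [HK H]]].
destruct (HQ K HK) as [B HB].
assert (HB0 : (0 <= B)%R).
{ assert (H0 := HB 0 0 ltac:(rewrite Cmod_0; lra) ltac:(rewrite Cmod_0; lra)).
  assert (H1 := Cmod_ge_0 (Q 0 0)); lra. }
assert (Hs : (0 <= Cmod q < 1)%R) by (split; [apply Cmod_ge_0|exact Hq1]).
apply (is_C_derive_sum (fun m w => punctured F q m0 w m)
  (punctured (fun X => / w0 * F' X) q m0 w0) _ w0 l d
  (fun m => (K * K * K * B) * Cmod q ^ Z.abs_nat m)%R
  (K * K * K * B * (2 * / (1 - Cmod q)))%R).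
- intros w Hw; destruct (H w Hw) as [Hw1 Hw2]; apply Hsum; [exact Hw1|].
  intros m Hm; apply Hw2, Hm.
- exact Hl.
- intros G Hd; rewrite rsum_scal.
  apply Rmult_le_compat_l.
  + apply Rmult_le_pos; [repeat apply Rmult_le_pos; lra|exact HB0].
  + apply (rsum_Z_abs_le (fun k => Cmod q ^ k)%R); [| |exact Hd].
    * intros k; apply pow_le; lra.
    * intros N; apply rsum_geometric_le, Hs.
- intros m w Hw; unfold punctured; destruct (Z.eq_dec m m0) as [_|Hm].
  + replace (0 - 0 - (w - w0) * 0) with (RtoC 0) by ring; rewrite Cmod_0.
    repeat apply Rmult_le_pos; try lra; try apply Cmod_ge_0.
    apply pow_le; lra.
  + destruct (H w Hw) as [_ Hw2]; destruct (Hw2 m Hm) as [H1 [H2 H3]].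
    destruct (H w0) as [_ Hw3].
    { replace (w0 - w0) with (RtoC 0) by ring; rewrite Cmod_0; apply cond_pos. }
    destruct (Hw3 m Hm) as [H4 [H5 H6]].
    rewrite HF by assumption; rewrite (Cmod_mult _ (Q _ _)).
    rewrite (Cmod_mult ((w - w0) * (w - w0))), (Cmod_mult (w - w0)).
    set (h := (Cmod (w - w0) * Cmod (w - w0))%R).
    assert (Hh : (0 <= h)%R) by (apply Rmult_le_pos; apply Cmod_ge_0).
    rewrite Rmult_assoc, (Rmult_comm _ h).
    apply Rmult_le_compat_l; [exact Hh|].
    replace (K * K * K * B * Cmod q ^ Z.abs_nat m)%R
      with (K * K * K * Cmod q ^ Z.abs_nat m * B)%R by ring.
    apply Rmult_le_compat; try apply Cmod_ge_0; [|apply HB; assumption].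
    apply Cpowz_weight3; assumption.
Qed.

Lemma Cmod_le_of_sum (x y : C) (a b : R) :
  (Cmod x <= a)%R -> (Cmod y <= b)%R -> (Cmod (x + y) <= a + b)%R.
Proof. intros Hx Hy; eapply Rle_trans; [apply Cmod_triangle|lra]. Qed.

Lemma Cmod_le_of_mult (x y : C) (a b : R) :
  (Cmod x <= a)%R -> (Cmod y <= b)%R -> (Cmod (x * y) <= a * b)%R.
Proof.
intros Hx Hy; rewrite Cmod_mult; apply Rmult_le_compat;
  try apply Cmod_ge_0; assumption.
Qed.

Lemma Cmod_le_of_real (r : R) : (Cmod r <= Rabs r)%R.
Proof. rewrite Cmod_R; lra. Qed.

Lemma is_C_derive_punctured_koebe (q : C) (m0 : Z) (w0 : C) :
  q <> 0 -> (Cmod q < 1)%R -> w0 <> 0 -> avoids_poles q m0 w0 ->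
  is_derive (fun w => sum_over (punctured koebe q m0 w)) w0
    (/ w0 * sum_over (punctured theta_koebe q m0 w0)).
Proof.
intros Hq Hq1 Hw0 Hav.
(* With p = 1 / (1 - X), [koebe] is p^2 - p; the quadratic remainder of p^2 has the
   factor y + 2 x, that of p the factor 1. *)
apply (is_C_derive_punctured koebe (fun x y => y + (2 * x + RtoC (-1)))
         theta_koebe); try assumption.
- intros w Hw Hw'; apply punctured_koebe_is_sum; assumption.
- apply is_sum_over_ext with (fun m => / w0 * punctured theta_koebe q m0 w0 m).
  + intros m; unfold punctured; destruct (Z.eq_dec m m0); ring.
  + apply is_sum_over_scal, punctured_theta_koebe_is_sum; assumption.
- intros w c H1 H2; unfold koebe, theta_koebe; field; repeat split; assumption.
- intros K HK; eexists; intros x y Hx Hy.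
  repeat first [apply Cmod_le_of_sum | apply Cmod_le_of_mult
               | eassumption | apply Cmod_le_of_real].
Qed.

Lemma ex_C_derive_punctured_theta_koebe (q : C) (m0 : Z) (w0 : C) :
  q <> 0 -> (Cmod q < 1)%R -> w0 <> 0 -> avoids_poles q m0 w0 ->
  ex_derive (fun w => sum_over (punctured theta_koebe q m0 w)) w0.
Proof.
intros Hq Hq1 Hw0 Hav.
(* With p = 1 / (1 - X), [theta_koebe] is 2 p^3 - 3 p^2 + p, and X d/dX acts as
   X p^2 d/dp. *)
set (F' := fun X => X * / (1 - X) * / (1 - X) *
  (6 * / (1 - X) * / (1 - X) + RtoC (-6) * / (1 - X) + 1)).
destruct (punctured_bounded (fun X => / w0 * F' X)
  (fun x => 6 * x * x + RtoC (-6) * x + 1) q m0 w0 Hq Hq1 Hw0 Hav)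
  as [B HB].
- intros c Hc; unfold F'; field; split; assumption.
- intros K HK; eexists; intros x Hx.
  repeat first [apply Cmod_le_of_sum | apply Cmod_le_of_mult
               | eassumption | apply Cmod_le_of_real].
- eexists.
  apply (is_C_derive_punctured theta_koebe
    (fun x y => 2 * (y * y + 2 * x * y + 3 * x * x)
                + RtoC (-3) * (y + 2 * x) + 1) F'); try assumption.
  + intros w Hw Hw'; apply punctured_theta_koebe_is_sum; assumption.
  + exact (is_sum_over_sum_over _ B HB).
  + intros w c H1 H2; unfold theta_koebe, F'; field; repeat split; assumption.
  + intros K HK; eexists; intros x y Hx Hy.
    repeat first [apply Cmod_le_of_sum | apply Cmod_le_of_mult
                 | eassumption | apply Cmod_le_of_real].
Qed.

(** * The Weierstrass function as a [q]-series *)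

(** [Im (x tau + y) = x Im tau] controls [x], and then [y]. *)
Lemma real_lattice_norm (tau : C) :
  (0 < Im tau)%R ->
  exists k, (0 < k)%R /\ forall x y : R,
    (k * (Rabs x + Rabs y) <= Cmod (x * tau + y))%R.
Proof.
intros Ht; set (t := Im tau) in *.
assert (HM := Cmod_ge_0 tau); set (M := Cmod tau) in *.
assert (Hk : (0 < 1 + (1 + M) / t)%R).
{ assert (0 < (1 + M) / t)%R by (apply Rdiv_lt_0_compat; lra); lra. }
exists (/ (1 + (1 + M) / t))%R; split; [apply Rinv_0_lt_compat, Hk|].
intros x y; set (z := x * tau + y).
assert (Hx : (Rabs x * t <= Cmod z)%R).
{ replace (Rabs x * t)%R with (Rabs (Im z)); [apply Im_le_Cmod|].
  unfold z; destruct tau as [a b]; simpl in t |- *; unfold t.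
  replace (x * b + 0 * a + 0)%R with (x * b)%R by ring.
  rewrite Rabs_mult, (Rabs_pos_eq b); [reflexivity|unfold t in Ht; lra]. }
assert (Hy : (Rabs y <= Cmod z + Rabs x * M)%R).
{ rewrite <- (Cmod_R y), <- (Cmod_R x); unfold M; rewrite <- Cmod_mult.
  replace (RtoC y) with (z - x * tau) by (unfold z; ring).
  apply Cmod_minus_le. }
apply Rmult_le_reg_l with (1 + (1 + M) / t)%R; [exact Hk|].
rewrite <- Rmult_assoc, Rinv_r, Rmult_1_l by lra.
assert (Hx' : (Rabs x <= Cmod z / t)%R).
{ apply Rmult_le_reg_r with t; [exact Ht|].
  replace (Cmod z / t * t)%R with (Cmod z) by (field; lra); exact Hx. }
assert (Hx0 := Rabs_pos x).
replace ((1 + (1 + M) / t) * Cmod z)%R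
  with (Cmod z + (1 + M) * (Cmod z / t))%R by (field; lra).
assert ((1 + M) * Rabs x <= (1 + M) * (Cmod z / t))%R
  by (apply Rmult_le_compat_l; lra).
lra.
Qed.

Definition pair_size (p : Z * Z) : R :=
  INR (S (Z.abs_nat (fst p) + Z.abs_nat (snd p))).

Lemma pair_size_ge_1 (p : Z * Z) : (1 <= pair_size p)%R.
Proof. apply (le_INR 1); lia. Qed.

Lemma pair_size_eq (p : Z * Z) :
  pair_size p = (1 + (Rabs (IZR (fst p)) + Rabs (IZR (snd p))))%R.
Proof.
unfold pair_size; rewrite S_INR, plus_INR, !INR_IZR_INZ, !Zabs2Nat.id_abs, !abs_IZR.
ring.
Qed.

Lemma pair_norm_ge_1 (p : Z * Z) :
  p <> (0%Z, 0%Z) -> (1 <= Rabs (IZR (fst p)) + Rabs (IZR (snd p)))%R.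
Proof.
intros Hp; rewrite <- !abs_IZR, <- plus_IZR; apply IZR_le.
destruct p as [m n]; simpl.
destruct (Z.eq_dec m 0) as [->|]; [|lia].
destruct (Z.eq_dec n 0) as [->|]; [contradiction|lia].
Qed.

Lemma lattice_pt_ge (tau : C) :
  (0 < Im tau)%R -> exists k, (0 < k)%R /\ forall p, p <> (0%Z, 0%Z) ->
    (k * pair_size p <= Cmod (lattice_pt tau p))%R.
Proof.
intros Ht; destruct (real_lattice_norm tau Ht) as [k [Hk H]].
exists (k / 2)%R; split; [lra|]; intros p Hp.
eapply Rle_trans; [|apply H].
assert (H1 := pair_norm_ge_1 p Hp); rewrite pair_size_eq.
unfold Rdiv; rewrite Rmult_assoc; apply Rmult_le_compat_l; lra.
Qed.

(** Far away, [u] is negligible against the lattice point; finitely many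
    lattice points remain. *)
Lemma lattice_distance (tau u : C) :
  (0 < Im tau)%R -> ~ is_lattice_pt tau u ->
  exists d, (0 < d)%R /\ forall p,
    (d * pair_size p <= Cmod (u - lattice_pt tau p))%R.
Proof.
intros Ht Hu; destruct (lattice_pt_ge tau Ht) as [k [Hk H]].
assert (Hu0 := Cmod_ge_0 u).
destruct (INR_unbounded (2 * Cmod u / k)) as [N HN].
destruct (finite_positive_lower_bound
  (fun p => Cmod (u - lattice_pt tau p) / pair_size p)%R
  (list_prod (Zrange (S N)) (Zrange (S N)))) as [d [Hd Hmin]].
exists (Rmin d (k / 2)); split; [apply Rmin_case; lra|]; intros p.
assert (HL := pair_size_ge_1 p).
assert (Hpos : (0 < Cmod (u - lattice_pt tau p))%R).
{ apply Cmod_gt_0; intros E; apply Hu; exists p.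
  replace u with (u - lattice_pt tau p + lattice_pt tau p) by ring.
  rewrite E; ring. }
destruct (le_lt_dec (Z.abs_nat (fst p) + Z.abs_nat (snd p)) N) as [HpN|HpN].
- apply Rle_trans with (d * pair_size p)%R.
  { apply Rmult_le_compat_r; [lra|apply Rmin_l]. }
  apply Rmult_le_reg_r with (/ pair_size p)%R; [apply Rinv_0_lt_compat; lra|].
  rewrite Rmult_assoc, Rinv_r, Rmult_1_r by lra; apply Hmin.
  + destruct p as [m n]; apply in_prod; apply In_Zrange; simpl in HpN; lia.
  + apply Rdiv_lt_0_compat; lra.
- assert (Hp : p <> (0%Z, 0%Z)) by (intros ->; simpl in HpN; lia).
  specialize (H p Hp).
  assert (HNp : (INR N <= pair_size p)%R) by (apply le_INR; lia).
  assert (Hku : (2 * Cmod u <= k * pair_size p)%R).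
  { replace (2 * Cmod u)%R with (k * (2 * Cmod u / k))%R by (field; lra).
    apply Rmult_le_compat_l; lra. }
  apply Rle_trans with (k / 2 * pair_size p)%R.
  { apply Rmult_le_compat_r; [lra|apply Rmin_r]. }
  rewrite Cmod_minus_sym.
  eapply Rle_trans; [|apply Cmod_minus_ge]; lra.
Qed.

Definition wp_term (tau u : C) (p : Z * Z) : C :=
  match p with
  | (0%Z, 0%Z) => 0
  | _ => 1 / (u - lattice_pt tau p) ^ 2 - 1 / lattice_pt tau p ^ 2
  end.

Definition E2_term (tau : C) (m n : Z) : C :=
  match m, n with
  | 0%Z, 0%Z => 0
  | _, _ => 1 / (ZtoC m * tau + ZtoC n) ^ 2
  end.

Lemma pair_eq_dec (p : Z * Z) : {p = (0%Z, 0%Z)} + {p <> (0%Z, 0%Z)}.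
Proof. apply eq_dec_classic. Qed.

Lemma wp_term_eq (tau u : C) (p : Z * Z) :
  p <> (0%Z, 0%Z) ->
  wp_term tau u p = 1 / (u - lattice_pt tau p) ^ 2 - 1 / lattice_pt tau p ^ 2.
Proof.
intros Hp; destruct p as [[|a|a] [|b|b]]; try reflexivity; contradiction.
Qed.

Lemma E2_term_eq (tau : C) (m n : Z) :
  (m, n) <> (0%Z, 0%Z) -> E2_term tau m n = 1 / lattice_pt tau (m, n) ^ 2.
Proof.
intros Hp; destruct m as [|a|a], n as [|b|b]; try reflexivity; contradiction.
Qed.

Lemma not_lattice_minus (tau u : C) (p : Z * Z) :
  ~ is_lattice_pt tau u -> u - lattice_pt tau p <> 0.
Proof.
intros Hu E; apply Hu; exists p.
replace u with (u - lattice_pt tau p + lattice_pt tau p) by ring.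
rewrite E; ring.
Qed.

(** Factoring out [u], the term is [u (1 / (o (u - o)^2) - 1 / (o^2 (u - o)))]
    at the lattice point [o], of cubic decay. *)
Lemma wp_term_bounded (tau u : C) :
  (0 < Im tau)%R -> ~ is_lattice_pt tau u ->
  exists B, bounded_sums (wp_term tau u) B.
Proof.
intros Ht Hu.
destruct (lattice_pt_ge tau Ht) as [k [Hk H]].
destruct (lattice_distance tau u Ht Hu) as [d [Hd H']].
set (K := (Cmod u * (/ (k * d * d) + / (k * k * d)))%R).
assert (HK : (0 <= K)%R).
{ apply Rmult_le_pos; [apply Cmod_ge_0|].
  assert (0 < / (k * d * d))%R
    by (apply Rinv_0_lt_compat; repeat apply Rmult_lt_0_compat; assumption).
  assert (0 < / (k * k * d))%R
    by (apply Rinv_0_lt_compat; repeat apply Rmult_lt_0_compat; assumption).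
  lra. }
exists (K * 36)%R; apply bounded_sums_weight2; intros p.
assert (HL := pair_size_ge_1 p).
apply Rle_trans with (K * / (pair_size p * pair_size p * pair_size p))%R.
2:{ apply Rmult_le_compat_l; [exact HK|].
    apply weight2_of_cube_le; unfold pair_size; apply le_INR; lia. }
set (L := pair_size p) in *.
assert (HLLL : (0 < / (L * L * L))%R)
  by (apply Rinv_0_lt_compat; repeat apply Rmult_lt_0_compat; lra).
destruct (pair_eq_dec p) as [->|Hp].
{ simpl; rewrite Cmod_0; apply Rmult_le_pos; lra. }
rewrite wp_term_eq by exact Hp.
specialize (H p Hp); specialize (H' p); fold L in H, H'.
assert (HkL : (0 < k * L)%R) by (apply Rmult_lt_0_compat; lra).
assert (HdL : (0 < d * L)%R) by (apply Rmult_lt_0_compat; lra).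
assert (Hz2 := not_lattice_minus tau u p Hu).
set (o := lattice_pt tau p) in *.
assert (Hz1 : o <> 0) by (apply Cmod_gt_0; lra).
replace (1 / (u - o) ^ 2 - 1 / o ^ 2)
  with (u * (/ o * / (u - o) * / (u - o) - / o * / o * / (u - o)))
  by (field; split; assumption).
rewrite Cmod_mult; unfold K; rewrite Rmult_assoc.
apply Rmult_le_compat_l; [apply Cmod_ge_0|].
eapply Rle_trans; [apply Cmod_minus_le|].
rewrite !Cmod_mult, !Cmod_inv by assumption.
assert (Ho : (0 < / Cmod o <= / (k * L))%R).
{ split; [apply Rinv_0_lt_compat|apply Rinv_le_contravar]; lra. }
assert (Huo : (0 < / Cmod (u - o) <= / (d * L))%R).
{ split; [apply Rinv_0_lt_compat|apply Rinv_le_contravar]; lra. }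
set (a := (/ Cmod o)%R) in *; set (b := (/ Cmod (u - o))%R) in *.
rewrite Rmult_plus_distr_r; apply Rplus_le_compat.
- replace (/ (k * d * d) * / (L * L * L))%R
    with (/ (k * L) * / (d * L) * / (d * L))%R by (field; lra).
  repeat apply Rmult_le_compat; try apply Rmult_le_pos; lra.
- replace (/ (k * k * d) * / (L * L * L))%R
    with (/ (k * L) * / (k * L) * / (d * L))%R by (field; lra).
  repeat apply Rmult_le_compat; try apply Rmult_le_pos; lra.
Qed.

Lemma lattice_row_non_integer (tau u : C) (m : Z) :
  ~ is_lattice_pt tau u -> non_integer (u - ZtoC m * tau).
Proof.
intros Hu n E; apply Hu; exists (m, (- n)%Z); unfold lattice_pt; simpl fst; simpl snd.
rewrite ZtoC_opp.
replace u with (u - ZtoC m * tau + ZtoC n + (ZtoC m * tau + - ZtoC n)) by ring.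
rewrite E; ring.
Qed.

Lemma Herglotz_opp (v : C) :
  non_integer v ->
  is_sum_over (fun n => 1 / (v - ZtoC n) ^ 2)
    (two_pi_i ^ 2 * koebe (Cexp (two_pi_i * v))).
Proof.
intros Hv; apply is_sum_over_ext with (fun n => inv_square_shift v (- n)).
- intros n; unfold inv_square_shift; rewrite ZtoC_opp; reflexivity.
- apply (is_sum_over_reindex (fun n => - n)%Z (fun n => - n)%Z);
    [intros; lia..|apply Herglotz, Hv].
Qed.

(** For [m <> 0] the row is a Herglotz series; for [m = 0] it is the series of
    [1 / n^2], dominated by the weights. *)
Lemma E2_row_is_sum (tau : C) (m : Z) :
  (0 < Im tau)%R -> is_sum_over (E2_term tau m) (sum_over (E2_term tau m)).
Proof.
intros Ht; destruct (Z.eq_dec m 0) as [->|Hm].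
- apply (is_sum_over_sum_over _ (4 * 6)), bounded_sums_weight; intros n.
  destruct (Z.eq_dec n 0) as [->|Hn].
  + simpl; rewrite Cmod_0; assert (H := weight_pos 0); lra.
  + rewrite E2_term_eq by (intros H; injection H; exact Hn).
    unfold lattice_pt; simpl fst; simpl snd.
    replace (ZtoC 0 * tau + ZtoC n) with (RtoC (IZR n)) by (unfold ZtoC; ring).
    rewrite <- RtoC_pow.
    assert (Hn1 : (1 <= Rabs (IZR n))%R)
      by (rewrite <- abs_IZR; apply IZR_le; lia).
    assert (Hn0 : RtoC (IZR n ^ 2) <> 0).
    { apply Cmod_gt_0; rewrite Cmod_R, <- RPow_abs; simpl; nra. }
    rewrite Cmod_div, Cmod_1, Cmod_R, <- RPow_abs by exact Hn0.
    set (j := INR (S (Z.abs_nat n))).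
    assert (Hj : j = (1 + Rabs (IZR n))%R).
    { unfold j; rewrite S_INR, INR_IZR_INZ, Zabs2Nat.id_abs, abs_IZR; ring. }
    apply Rle_trans with (4 * / (j * j))%R.
    * replace (4 * / (j * j))%R with (/ (j / 2 * (j / 2)))%R by (field; lra).
      unfold Rdiv at 1; rewrite Rmult_1_l; apply Rinv_le_contravar; simpl; nra.
    * apply Rmult_le_compat_l; [lra|apply weight_of_square_le, Rle_refl].
- assert (Hv : non_integer (ZtoC m * tau)).
  { intros n E; apply (f_equal Im) in E; destruct tau as [a b].
    simpl in E, Ht.
    assert (E' : (IZR m * b = 0)%R) by lra.
    apply Rmult_integral in E'; destruct E' as [E'|E']; [|lra].
    apply Hm, eq_IZR, E'. }
  assert (H := Herglotz _ Hv).
  assert (H' : is_sum_over (E2_term tau m)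
    (two_pi_i ^ 2 * koebe (Cexp (two_pi_i * (ZtoC m * tau))))).
  { refine (is_sum_over_ext _ _ _ _ H); intros n.
    rewrite E2_term_eq by (intros H1; injection H1; intros; contradiction).
    reflexivity. }
  rewrite (sum_over_eq _ _ H'); exact H'.
Qed.

(** [exp (2 pi i u) q^m = 1] exactly when [u + m tau] is an integer. *)
Lemma lattice_iff_pole (tau u : C) :
  let q := Cexp (two_pi_i * tau) in
  is_lattice_pt tau u <-> is_calW_pole (Cexp (two_pi_i * u)) q.
Proof.
intros q; unfold is_calW_pole, q; split.
- intros [[m n] ->]; exists (- m)%Z; unfold lattice_pt; simpl fst; simpl snd.
  rewrite Cpowz_Cexp, <- Cexp_plus, ZtoC_opp.
  replace (_ + _) with (two_pi_i * ZtoC n) by ring.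
  apply Cexp_two_pi_i_Z.
- intros [m Hm]; rewrite Cpowz_Cexp, <- Cexp_plus in Hm.
  destruct (Cexp_eq_1 _ Hm) as [k Hk]; exists ((- m)%Z, k).
  unfold lattice_pt; simpl fst; simpl snd; rewrite ZtoC_opp.
  replace (two_pi_i * u + two_pi_i * tau * ZtoC m)
    with (two_pi_i * (u + tau * ZtoC m)) in Hk by ring.
  assert (H2 := two_pi_i_neq_0).
  replace u with (/ two_pi_i * (two_pi_i * (u + tau * ZtoC m)) - tau * ZtoC m)
    by (field; exact H2).
  rewrite Hk; field; exact H2.
Qed.

Lemma is_sum_over_unpuncture (F : C -> C) (q : C) (m0 : Z) (w s : C) :
  is_sum_over (punctured F q m0 w) s ->
  is_sum_over (fun m => F (w * Cpowz q m)) (F (w * Cpowz q m0) + s).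
Proof.
intros Hs; set (g := fun m : Z => if Z.eq_dec m m0 then F (w * Cpowz q m) else 0).
assert (Hg : is_sum_over g (F (w * Cpowz q m0))).
{ replace (F (w * Cpowz q m0)) with (g m0)
    by (unfold g; destruct (Z.eq_dec m0 m0); [reflexivity|contradiction]).
  apply is_sum_over_single; intros m Hm; unfold g.
  destruct (Z.eq_dec m m0); [contradiction|reflexivity]. }
refine (is_sum_over_ext _ _ _ _ (is_sum_over_plus _ _ _ _ Hg Hs)).
intros m; unfold g, punctured; destruct (Z.eq_dec m m0); ring.
Qed.

Lemma calW_is_sum (q : C) (m0 : Z) (w : C) :
  q <> 0 -> (Cmod q < 1)%R -> w <> 0 -> avoids_poles q m0 w ->
  is_sum_over (fun m => koebe (w * Cpowz q m))
    (koebe (w * Cpowz q m0) + sum_over (punctured koebe q m0 w)).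
Proof.
intros Hq Hq1 Hw Hav; apply is_sum_over_unpuncture.
apply punctured_koebe_is_sum; assumption.
Qed.

Lemma not_pole_avoids (q w : C) (m0 : Z) :
  ~ is_calW_pole w q -> avoids_poles q m0 w.
Proof.
intros Hw m _ E; apply Hw; exists m.
replace (w * Cpowz q m) with (1 - (1 - w * Cpowz q m)) by ring.
rewrite E; ring.
Qed.

Lemma calW_eq (q : C) (m0 : Z) (w : C) :
  q <> 0 -> (Cmod q < 1)%R -> w <> 0 -> avoids_poles q m0 w ->
  calW w q = koebe (w * Cpowz q m0) + sum_over (punctured koebe q m0 w).
Proof. intros Hq Hq1 Hw Hav; apply sum_over_eq, calW_is_sum; assumption. Qed.

Lemma Cmod_nome_lt_1 (tau : C) :
  (0 < Im tau)%R -> (Cmod (Cexp (two_pi_i * tau)) < 1)%R.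
Proof.
intros Ht; rewrite Cmod_Cexp, <- exp_0; apply exp_increasing.
rewrite two_pi_i_eq; destruct tau as [a b]; simpl in *.
assert (HPI := PI_RGT_0).
assert (0 < 2 * PI * b)%R by (apply Rmult_lt_0_compat; lra); lra.
Qed.

(** For each [m] the row of the [wp] series is the difference of a Herglotz
    series and of an inner sum of [E2], up to the term [1 / u^2] that [wp]
    adds separately; Fubini then sums the rows. *)
Lemma wp_eq_calW (tau u : C) :
  (0 < Im tau)%R -> ~ is_lattice_pt tau u ->
  wp tau u = two_pi_i ^ 2 * calW (Cexp (two_pi_i * u)) (Cexp (two_pi_i * tau))
             - PI ^ 2 / 3 * E2 tau.
Proof.
intros Ht Hu; set (q := Cexp (two_pi_i * tau)); set (w := Cexp (two_pi_i * u)).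
assert (Hu0 : u <> 0).
{ intros E; apply Hu; exists (0%Z, 0%Z); rewrite E; unfold lattice_pt, ZtoC.
  simpl; ring. }
destruct (wp_term_bounded tau u Ht Hu) as [B HB].
destruct (bounded_sums_is_sum _ B HB) as [s Hs].
assert (Hwp : wp tau u = 1 / u ^ 2 + s).
{ unfold wp; f_equal; exact (sum_over_eq _ _ Hs). }
(* [d] carries the term 1 / u^2 at the origin, which the [wp] series omits but the
   Herglotz series of the row [m = 0] contains. *)
set (a := fun m : Z => two_pi_i ^ 2 * koebe (w * Cpowz q (- m))).
set (e := fun m : Z => sum_over (E2_term tau m)).
set (d := fun m : Z => if Z.eq_dec m 0 then 1 / u ^ 2 else 0).
assert (Hrow : forall m, is_sum_over (fun n => wp_term tau u (m, n)) (a m - e m - d m)).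
{ intros m.
  assert (HA := Herglotz_opp _ (lattice_row_non_integer tau u m Hu)).
  assert (HD : is_sum_over (fun n => if Z.eq_dec n 0 then d m else 0) (d m)).
  { assert (H := is_sum_over_single
      (fun n => if Z.eq_dec n 0 then d m else 0) 0%Z).
    apply H; intros n Hn; destruct (Z.eq_dec n 0); [contradiction|reflexivity]. }
  assert (HS := is_sum_over_minus _ _ _ _
    (is_sum_over_minus _ _ _ _ HA (E2_row_is_sum tau m Ht)) HD).
  replace (a m) with
    (two_pi_i ^ 2 * koebe (Cexp (two_pi_i * (u - ZtoC m * tau)))).
  2:{ unfold a, w, q; rewrite Cpowz_Cexp, <- Cexp_plus, ZtoC_opp.
      do 3 f_equal; ring. }
  refine (is_sum_over_ext _ _ _ _ HS); intros n.
  destruct (pair_eq_dec (m, n)) as [E|Hp].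
  - injection E; intros -> ->; unfold d; simpl.
    destruct (Z.eq_dec 0 0); [|contradiction].
    unfold ZtoC.
    replace (u - 0 * tau - 0) with u by ring; ring.
  - rewrite wp_term_eq, E2_term_eq by exact Hp.
    replace (if Z.eq_dec n 0 then d m else 0) with (RtoC 0).
    + unfold lattice_pt; simpl fst; simpl snd.
      replace (u - ZtoC m * tau - ZtoC n) with (u - (ZtoC m * tau + ZtoC n)) by ring.
      ring.
    + unfold d; destruct (Z.eq_dec n 0), (Z.eq_dec m 0); try reflexivity.
      subst; contradiction. }
assert (Hcol := is_sum_over_Fubini _ _ _ Hs Hrow).
assert (Hq : q <> 0) by apply Cexp_neq_0.
assert (Hq1 : (Cmod q < 1)%R) by (apply Cmod_nome_lt_1, Ht).
assert (Hw : w <> 0) by apply Cexp_neq_0.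
assert (Hav : avoids_poles q 0 w).
{ apply not_pole_avoids; intros H; apply Hu, lattice_iff_pole, H. }
assert (HW : is_sum_over a (two_pi_i ^ 2 * calW w q)).
{ apply is_sum_over_scal.
  apply (is_sum_over_reindex (fun m => - m)%Z (fun m => - m)%Z
           (fun m => koebe (w * Cpowz q m))); [intros; lia..|].
  rewrite (calW_eq q 0 w Hq Hq1 Hw Hav); apply calW_is_sum; assumption. }
assert (HD : is_sum_over d (1 / u ^ 2)).
{ assert (H := is_sum_over_single d 0%Z).
  apply H; intros m Hm; unfold d; destruct (Z.eq_dec m 0);
    [contradiction|reflexivity]. }
assert (He : is_sum_over e (two_pi_i ^ 2 * calW w q - s - 1 / u ^ 2)).
{ refine (is_sum_over_ext _ _ _ _ (is_sum_over_minus _ _ _ _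
    (is_sum_over_minus _ _ _ _ HW Hcol) HD)).
  intros m; ring. }
assert (HE2 : E2 tau = 3 / PI ^ 2 * (two_pi_i ^ 2 * calW w q - s - 1 / u ^ 2)).
{ unfold E2; f_equal; exact (sum_over_eq _ _ He). }
rewrite Hwp, HE2.
assert (H3 : RtoC 3 <> 0) by (intros E; apply RtoC_inj in E; lra).
assert (HP := PI_C_neq_0).
field; repeat split; assumption.
Qed.

(** * The map to the elliptic curve *)

Lemma is_C_derive_inv (z : C) :
  z <> 0 -> is_derive (fun w : C => / w) z (- / (z * z)).
Proof.
intros Hz; assert (Hr : (0 < Cmod z)%R) by (apply Cmod_gt_0, Hz).
assert (Hd : (0 < Cmod z / 2)%R) by lra.
apply (is_C_derive_square _ z _ (mkposreal _ Hd)
  (/ (Cmod z * Cmod z) * (2 / Cmod z))); simpl pos; intros w Hw.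
assert (Hge : (Cmod z / 2 <= Cmod w)%R).
{ replace w with (z - (z - w)) by ring.
  eapply Rle_trans; [|apply Cmod_minus_ge]; rewrite Cmod_minus_sym in Hw; lra. }
assert (Hw0 : w <> 0) by (apply Cmod_gt_0; lra).
replace (/ w - / z - (w - z) * - / (z * z))
  with (/ (z * z) * / w * ((w - z) * (w - z))) by (field; split; assumption).
rewrite !(Cmod_mult _ ((w - z) * (w - z))), (Cmod_mult (w - z)).
apply Rmult_le_compat_r; [apply Rmult_le_pos; apply Cmod_ge_0|].
rewrite Cmod_mult, !Cmod_inv, Cmod_mult
  by (try apply Cmult_neq_0; assumption).
apply Rmult_le_compat_l.
- left; apply Rinv_0_lt_compat; apply Rmult_lt_0_compat; lra.
- replace (2 / Cmod z)%R with (/ (Cmod z / 2))%R by (field; lra).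
  apply Rinv_le_contravar; lra.
Qed.

Lemma is_C_derive_koebe_scal (c w : C) :
  w <> 0 -> 1 - w * c <> 0 ->
  is_derive (fun v => koebe (v * c)) w (/ w * theta_koebe (w * c)).
Proof.
intros Hw Hc.
assert (Hv : is_derive (fun v : C => 1 - v * c) w (0 - (1 * c + w * 0))).
{ apply is_C_derive_minus; [apply is_C_derive_const|].
  apply is_C_derive_mult; [apply is_C_derive_id|apply is_C_derive_const]. }
assert (Hi := is_C_derive_comp (fun v => / v) (fun v => 1 - v * c) w _ _
  (is_C_derive_inv _ Hc) Hv).
assert (Hm := is_C_derive_mult _ _ w _ _ (is_C_derive_mult _ _ w _ _
  (is_C_derive_mult _ _ w _ _ (is_C_derive_id w) (is_C_derive_const c w)) Hi) Hi).
simpl in Hm.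
match type of Hm with is_derive _ _ ?l =>
  replace (/ w * theta_koebe (w * c)) with l end.
2:{ unfold theta_koebe; field; split; assumption. }
assert (Hd : (0 < Cmod (1 - w * c) / (Cmod c + 1))%R).
{ apply Rdiv_lt_0_compat; [apply Cmod_gt_0, Hc|].
  assert (H := Cmod_ge_0 c); lra. }
refine (is_C_derive_ext_loc _ _ w _ (mkposreal _ Hd) _ Hm).
simpl pos; intros v Hvw; unfold koebe.
assert (Hvc : 1 - v * c <> 0).
{ intros E.
  assert (E' : 1 - w * c = (v - w) * c)
    by (transitivity (1 - v * c + (v - w) * c); [ring|rewrite E; ring]).
  rewrite E', Cmod_mult in Hvw; assert (H := Cmod_ge_0 c).
  assert (H' := Cmod_ge_0 (v - w)).
  apply (Rmult_lt_compat_r (Cmod c + 1)) in Hvw; [|lra].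
  unfold Rdiv in Hvw; rewrite Rmult_assoc, Rinv_l, Rmult_1_r in Hvw by lra.
  lra. }
field; exact Hvc.
Qed.

(** [w * d/dw] applied to [calW w q]. *)
Definition calD (w q : C) : C :=
  sum_over (fun m : Z => theta_koebe (w * Cpowz q m)).

Lemma calD_is_sum (q : C) (m0 : Z) (w : C) :
  q <> 0 -> (Cmod q < 1)%R -> w <> 0 -> avoids_poles q m0 w ->
  is_sum_over (fun m => theta_koebe (w * Cpowz q m))
    (theta_koebe (w * Cpowz q m0) + sum_over (punctured theta_koebe q m0 w)).
Proof.
intros Hq Hq1 Hw Hav; apply is_sum_over_unpuncture.
apply punctured_theta_koebe_is_sum; assumption.
Qed.

Lemma calD_eq (q : C) (m0 : Z) (w : C) :
  q <> 0 -> (Cmod q < 1)%R -> w <> 0 -> avoids_poles q m0 w ->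
  calD w q = theta_koebe (w * Cpowz q m0)
             + sum_over (punctured theta_koebe q m0 w).
Proof. intros Hq Hq1 Hw Hav; apply sum_over_eq, calD_is_sum; assumption. Qed.

Lemma avoids_poles_open (q : C) (m0 : Z) (w0 : C) :
  q <> 0 -> (Cmod q < 1)%R -> w0 <> 0 -> avoids_poles q m0 w0 ->
  exists d : posreal, forall w, (Cmod (w - w0) < d)%R ->
    w <> 0 /\ avoids_poles q m0 w.
Proof.
intros Hq Hq1 Hw0 Hav.
destruct (resolvent_bound q m0 w0 Hq Hq1 Hw0 Hav) as [d [K [_ H]]].
exists d; intros w Hw; destruct (H w Hw) as [H1 H2].
split; [exact H1|]; intros m Hm; apply H2, Hm.
Qed.

Lemma is_C_derive_calW (q w : C) :
  q <> 0 -> (Cmod q < 1)%R -> w <> 0 -> ~ is_calW_pole w q ->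
  is_derive (fun v => calW v q) w (/ w * calD w q).
Proof.
intros Hq Hq1 Hw Hp.
assert (Hav := not_pole_avoids q w 0 Hp).
destruct (avoids_poles_open q 0 w Hq Hq1 Hw Hav) as [d Hd].
apply is_C_derive_ext_loc with (d := d)
  (f := fun v => koebe (v * Cpowz q 0) + sum_over (punctured koebe q 0 v)).
- intros v Hv; destruct (Hd v Hv); symmetry; apply calW_eq; assumption.
- rewrite (calD_eq q 0 w Hq Hq1 Hw Hav), Cmult_plus_distr_l.
  apply is_C_derive_plus.
  + apply is_C_derive_koebe_scal; [exact Hw|].
    apply (not_pole_avoids q w 1 Hp); discriminate.
  + apply is_C_derive_punctured_koebe; assumption.
Qed.

Lemma is_calW_pole_shift (q w : C) (k : Z) :
  q <> 0 -> is_calW_pole (w * Cpowz q k) q <-> is_calW_pole w q.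
Proof.
intros Hq; split; intros [m Hm].
- exists (k + m)%Z; rewrite Cpowz_plus, Cmult_assoc by exact Hq; exact Hm.
- exists (m - k)%Z; rewrite <- Hm, <- Cmult_assoc, <- Cpowz_plus by exact Hq.
  do 2 f_equal; ring.
Qed.

(** Multiplying [w] by [q^k] only shifts the index of summation. *)
Lemma sum_over_shift (F : C -> C) (q w s : C) (k : Z) :
  q <> 0 -> is_sum_over (fun m => F (w * Cpowz q m)) s ->
  sum_over (fun m => F (w * Cpowz q k * Cpowz q m))
  = sum_over (fun m => F (w * Cpowz q m)).
Proof.
intros Hq Hs; rewrite (sum_over_eq _ _ Hs); apply sum_over_eq.
apply is_sum_over_ext with (fun m => F (w * Cpowz q (k + m))).
- intros m; rewrite Cpowz_plus, Cmult_assoc by exact Hq; reflexivity.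
- apply (is_sum_over_reindex (fun m => k + m)%Z (fun m => m - k)%Z
           (fun m => F (w * Cpowz q m))); [intros; ring..|exact Hs].
Qed.

Lemma calW_shift (q w : C) (k : Z) :
  q <> 0 -> (Cmod q < 1)%R -> w <> 0 -> ~ is_calW_pole w q ->
  calW (w * Cpowz q k) q = calW w q.
Proof.
intros Hq Hq1 Hw Hp; eapply (sum_over_shift koebe); [exact Hq|].
apply (calW_is_sum q 0 w Hq Hq1 Hw), not_pole_avoids, Hp.
Qed.

Lemma calD_shift (q w : C) (k : Z) :
  q <> 0 -> (Cmod q < 1)%R -> w <> 0 -> ~ is_calW_pole w q ->
  calD (w * Cpowz q k) q = calD w q.
Proof.
intros Hq Hq1 Hw Hp; eapply (sum_over_shift theta_koebe); [exact Hq|].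
apply (calD_is_sum q 0 w Hq Hq1 Hw), not_pole_avoids, Hp.
Qed.

Lemma not_lattice_open (tau u : C) :
  (0 < Im tau)%R -> ~ is_lattice_pt tau u ->
  exists d : posreal, forall v, (Cmod (v - u) < d)%R -> ~ is_lattice_pt tau v.
Proof.
intros Ht Hu; destruct (lattice_distance tau u Ht Hu) as [d [Hd H]].
exists (mkposreal d Hd); simpl pos; intros v Hv [p ->].
specialize (H p); assert (HL := pair_size_ge_1 p).
rewrite Cmod_minus_sym in Hv; nra.
Qed.

(** The identity of [wp_eq_calW] holds on a neighbourhood of [u] and can be
    differentiated; the chain rule along [exp (2 pi i u)] contributes [2 pi i
    w]. *)
Lemma wp'_eq_calD (tau u : C) :
  (0 < Im tau)%R -> ~ is_lattice_pt tau u ->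
  wp' tau u =
  two_pi_i ^ 3 * calD (Cexp (two_pi_i * u)) (Cexp (two_pi_i * tau)).
Proof.
intros Ht Hu; set (q := Cexp (two_pi_i * tau)).
assert (Hq : q <> 0) by apply Cexp_neq_0.
assert (Hq1 := Cmod_nome_lt_1 tau Ht); fold q in Hq1.
assert (Hp : ~ is_calW_pole (Cexp (two_pi_i * u)) q)
  by (intros H; apply Hu, lattice_iff_pole, H).
destruct (not_lattice_open tau u Ht Hu) as [d Hd].
apply is_C_derive_unique.
apply is_C_derive_ext_loc with (d := d)
  (f := fun v => two_pi_i ^ 2 * calW (Cexp (two_pi_i * v)) q - PI ^ 2 / 3 * E2 tau).
{ intros v Hv; symmetry; apply wp_eq_calW; [exact Ht|apply Hd, Hv]. }
assert (Hl : is_derive (fun v : C => two_pi_i * v) u (two_pi_i * 1))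
  by apply is_C_derive_scal, is_C_derive_id.
assert (He := is_C_derive_comp Cexp _ u _ _ (is_C_derive_Cexp _) Hl).
assert (HW := is_C_derive_comp (fun v => calW v q) _ u _ _
  (is_C_derive_calW q _ Hq Hq1 (Cexp_neq_0 _) Hp) He).
assert (H := is_C_derive_minus _ _ u _ _ (is_C_derive_scal (two_pi_i ^ 2) _ u _ HW)
  (is_C_derive_const (PI ^ 2 / 3 * E2 tau) u)).
simpl in H.
match type of H with is_derive _ _ ?l =>
  match goal with |- is_derive _ _ ?r => replace r with l end end; [exact H|].
field; apply Cexp_neq_0.
Qed.

Lemma proportional_refl (a : vec_nz) : proportional a a.
Proof.
exists 1; split; [apply C1_nz|].
destruct (proj1_sig a) as [[x y] z]; simpl; rewrite !Cmult_1_l; reflexivity.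
Qed.

Lemma scale3_scale3 (c d : C) (v : C3) :
  scale3 c (scale3 d v) = scale3 (c * d) v.
Proof. destruct v as [[x y] z]; simpl; rewrite !Cmult_assoc; reflexivity. Qed.

Lemma scale3_1 (v : C3) : scale3 1 v = v.
Proof. destruct v as [[x y] z]; simpl; rewrite !Cmult_1_l; reflexivity. Qed.

Lemma proportional_sym (a b : vec_nz) : proportional a b -> proportional b a.
Proof.
intros [c [Hc H]]; exists (/ c); split; [apply Cinv_neq_0, Hc|].
rewrite H, scale3_scale3, Cinv_l, scale3_1 by exact Hc; reflexivity.
Qed.

Lemma proportional_trans (a b c : vec_nz) :
  proportional a b -> proportional b c -> proportional a c.
Proof.
intros [x [Hx H]] [y [Hy H']]; exists (y * x); split.
- apply Cmult_neq_0; assumption.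
- rewrite H', H, scale3_scale3; reflexivity.
Qed.

Lemma has_coords_scale (x y z : C) (H : (x, y, z) <> (RtoC 0, RtoC 0, RtoC 0))
    (c x' y' z' : C) :
  c <> 0 -> x' = c * x -> y' = c * y -> z' = c * z ->
  has_coords (class proportional (exist _ (x, y, z) H)) x' y' z'.
Proof.
intros Hc -> -> ->.
assert (H' : (c * x, c * y, c * z) <> (RtoC 0, RtoC 0, RtoC 0)).
{ assert (Hz : forall t, c * t = 0 -> t = 0).
  { intros t E; replace t with (/ c * (c * t)) by (field; exact Hc).
    rewrite E; ring. }
  intros E; apply H; injection E as E1 E2 E3 E4 E5 E6.
  apply (f_equal2 pair); [apply (f_equal2 pair)|]; apply Hz;
    apply injective_projections; assumption. }
exists H'; apply class_eq; [exact proportional_refl|exact proportional_sym|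
  exact proportional_trans|].
exists c; split; [exact Hc|reflexivity].
Qed.

Lemma mod_exp_Gamma_w_class_eq (tau : C) (z z' : Cstar) :
  E_proj tau z = E_proj tau z' <-> mod_exp_Gamma_w tau z z'.
Proof.
apply class_eq.
- intros a; exists 0%Z; unfold ZtoC; rewrite Cmult_0_r, Cexp_0; ring.
- intros a b [n Hn]; exists (- n)%Z.
  rewrite Hn, ZtoC_opp, Cmult_assoc, <- Cexp_plus.
  replace (_ + _) with (RtoC 0) by ring; rewrite Cexp_0; ring.
- intros a b c [n Hn] [m Hm]; exists (m + n)%Z.
  rewrite Hm, Hn, ZtoC_plus, Cmult_assoc, <- Cexp_plus; do 2 f_equal; ring.
Qed.

Definition Clog (w : C) : C :=
  epsilon (inhabits (RtoC 0)) (fun x => Cexp x = w).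

Lemma Cexp_Clog (w : C) : w <> 0 -> Cexp (Clog w) = w.
Proof.
intros Hw; apply (epsilon_spec (inhabits (RtoC 0)) (fun x => Cexp x = w)).
apply Cexp_surj, Hw.
Qed.

(** Which logarithm is chosen is immaterial: changing it by [2 pi i] multiplies
    [exp (L / tau)] by an element of [exp(Gamma_w)]. *)
Definition w_to_E (tau : C) (w : Cstar) : E tau :=
  E_proj tau (exp_star (Clog (proj1_sig w) / tau)).

Lemma upper_half_plane_neq_0 (tau : C) : (0 < Im tau)%R -> tau <> 0.
Proof. intros Ht E; rewrite E in Ht; simpl in Ht; lra. Qed.

Lemma w_to_E_exp_star (tau x : C) :
  tau <> 0 -> w_to_E tau (exp_star (tau * x)) = E_proj tau (exp_star x).
Proof.
intros Ht; apply mod_exp_Gamma_w_class_eq; simpl proj1_sig.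
destruct (Cexp_eq _ _ (Cexp_Clog _ (Cexp_neq_0 (tau * x)))) as [k Hk].
exists (- k)%Z; unfold exp_star; simpl proj1_sig; rewrite <- Cexp_plus, Hk, ZtoC_opp.
f_equal; field; exact Ht.
Qed.

(** The representative chosen by [E_Log] differs from [Clog w / tau] by an
    element of [Gamma_g + Gamma_w]; its part in [Gamma_w] disappears in [exp (2
    pi i u)], the other one becomes the power of [q]. *)
Lemma E_embed_w_to_E (tau : C) (w : Cstar) :
  tau <> 0 -> exists u k, E_embed tau (w_to_E tau w) = wp_pt tau u /\
    Cexp (two_pi_i * u) = proj1_sig w * Cpowz (Cexp (two_pi_i * tau)) k.
Proof.
intros Ht; unfold E_embed.
assert (HE : E_proj tau (exp_star (E_Log tau (w_to_E tau w))) = w_to_E tau w).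
{ unfold E_Log.
  apply (epsilon_spec (inhabits (RtoC 0))
    (fun x => E_proj tau (exp_star x) = w_to_E tau w)).
  exists (Clog (proj1_sig w) / tau); reflexivity. }
set (y := E_Log tau (w_to_E tau w)) in *.
apply mod_exp_Gamma_w_class_eq in HE; destruct HE as [n Hn].
simpl proj1_sig in Hn; rewrite <- Cexp_plus in Hn.
destruct (Cexp_eq _ _ Hn) as [k Hk].
assert (H2 := two_pi_i_neq_0).
exists (tau / two_pi_i * y), (- k)%Z; split; [reflexivity|].
destruct w as [w Hw]; simpl proj1_sig in *.
rewrite <- (Cexp_Clog w Hw) at 1; rewrite Cpowz_Cexp, <- Cexp_plus.
replace (Clog w) with (tau * (Clog w / tau)) by (field; exact Ht).
rewrite Hk.
replace (two_pi_i * (tau / two_pi_i * y)) with (tau * y) by (field; exact H2).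
replace (tau * _ + _) with (tau * y + two_pi_i * ZtoC n)
  by (rewrite ZtoC_opp; field; exact Ht).
rewrite Cexp_plus, Cexp_two_pi_i_Z; ring.
Qed.

Lemma E_embed_w_to_E_affine (tau : C) (w : Cstar) :
  (0 < Im tau)%R ->
  let q := Cexp (two_pi_i * tau) in
  ~ is_calW_pole (proj1_sig w) q ->
  E_embed tau (w_to_E tau w) =
  affine_pt (two_pi_i ^ 2 * calW (proj1_sig w) q - PI ^ 2 / 3 * E2 tau)
    (two_pi_i ^ 3 * calD (proj1_sig w) q).
Proof.
intros Ht q Hp.
assert (Hq : q <> 0) by apply Cexp_neq_0.
assert (Hq1 : (Cmod q < 1)%R) by apply (Cmod_nome_lt_1 tau Ht).
destruct (E_embed_w_to_E tau w (upper_half_plane_neq_0 tau Ht)) as [u [k [-> Hu]]].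
fold q in Hu.
assert (Hl : ~ is_lattice_pt tau u).
{ intros H; apply lattice_iff_pole in H; fold q in H; rewrite Hu in H.
  apply Hp, (is_calW_pole_shift q _ k Hq), H. }
unfold wp_pt; destruct (excluded_middle_informative _) as [H|_]; [contradiction|].
rewrite wp_eq_calW, wp'_eq_calD by assumption; fold q; rewrite Hu.
destruct w as [w Hw]; simpl proj1_sig in *.
rewrite calW_shift, calD_shift by assumption; reflexivity.
Qed.

Lemma E_embed_w_to_E_infinity (tau : C) (w : Cstar) :
  (0 < Im tau)%R -> is_calW_pole (proj1_sig w) (Cexp (two_pi_i * tau)) ->
  E_embed tau (w_to_E tau w) = infinity_pt.
Proof.
intros Ht Hp.
destruct (E_embed_w_to_E tau w (upper_half_plane_neq_0 tau Ht)) as [u [k [-> Hu]]].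
assert (Hl : is_lattice_pt tau u).
{ apply lattice_iff_pole; rewrite Hu.
  apply is_calW_pole_shift; [apply Cexp_neq_0|exact Hp]. }
unfold wp_pt; destruct (excluded_middle_informative _); [reflexivity|contradiction].
Qed.

Lemma Cpowz_inj (q : C) (m n : Z) :
  q <> 0 -> (Cmod q < 1)%R -> Cpowz q m = Cpowz q n -> m = n.
Proof.
intros Hq Hq1 E; destruct (Cexp_surj q Hq) as [c Hc]; subst q.
rewrite !Cpowz_Cexp in E; apply (f_equal Cmod) in E.
rewrite Cmod_Cexp, <- exp_0 in Hq1; apply exp_lt_inv in Hq1.
rewrite !Cmod_Cexp in E; apply exp_inv in E.
destruct c as [a b]; simpl in E, Hq1.
apply eq_IZR, Rmult_eq_reg_l with a; lra.
Qed.

(** Two indices [m] with [w q^m = 1] would give [q] a nonzero power of modulus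
    [1]. *)
Lemma exists_avoids_poles (q w : C) :
  q <> 0 -> (Cmod q < 1)%R -> w <> 0 -> exists m0, avoids_poles q m0 w.
Proof.
intros Hq Hq1 Hw.
destruct (excluded_middle_informative (is_calW_pole w q)) as [[m0 H0]|Hp].
- exists m0; intros m Hm E; apply Hm, (Cpowz_inj q _ _ Hq Hq1).
  replace (Cpowz q m) with (/ w * (1 - (1 - w * Cpowz q m)))
    by (field; exact Hw).
  rewrite E; replace (1 - 0) with (RtoC 1) by ring.
  rewrite <- H0; field; exact Hw.
- exists 0%Z; apply not_pole_avoids, Hp.
Qed.

Lemma w_to_E_holomorphic (tau : C) :
  (0 < Im tau)%R -> holomorphic_P2 (fun w => E_embed tau (w_to_E tau w)).
Proof.
intros Ht [w0 Hw0]; simpl proj1_sig.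
set (q := Cexp (two_pi_i * tau)).
assert (Hq : q <> 0) by apply Cexp_neq_0.
assert (Hq1 : (Cmod q < 1)%R) by apply (Cmod_nome_lt_1 tau Ht).
destruct (exists_avoids_poles q w0 Hq Hq1 Hw0) as [m0 Hav].
destruct (avoids_poles_open q m0 w0 Hq Hq1 Hw0 Hav) as [d Hd].
set (c := Cpowz q m0).
set (a := fun w : C => w * c).
set (b := fun w : C => (1 - a w) * (1 - a w) * (1 - a w)).
set (R0 := fun w => sum_over (punctured koebe q m0 w)).
set (R1 := fun w => sum_over (punctured theta_koebe q m0 w)).
(* The affine coordinates multiplied by [b w = (1 - w q^m0)^3]. *)
exists (fun w => two_pi_i ^ 2 * (a w * (1 - a w) + b w * R0 w)
                 - (PI ^ 2 / 3 * E2 tau) * b w),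
  (fun w => two_pi_i ^ 3 * (a w * (1 + a w) + b w * R1 w)), b.
apply locally_C_Cmod; exists d; intros w Hw.
destruct (Hd w Hw) as [Hw' Havw].
assert (Da : is_derive a w (1 * c + w * 0)).
{ apply is_C_derive_mult; [apply is_C_derive_id|apply is_C_derive_const]. }
assert (D1 := is_C_derive_minus _ _ w _ _ (is_C_derive_const 1 w) Da).
assert (D1' := is_C_derive_plus _ _ w _ _ (is_C_derive_const 1 w) Da).
assert (Db := is_C_derive_mult _ _ w _ _ (is_C_derive_mult _ _ w _ _ D1 D1) D1).
assert (DR0 := is_C_derive_punctured_koebe q m0 w Hq Hq1 Hw' Havw).
destruct (ex_C_derive_punctured_theta_koebe q m0 w Hq Hq1 Hw' Havw) as [l1 DR1].
split; [|split; [|split]].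
- eexists; apply is_C_derive_minus; apply is_C_derive_scal; [|exact Db].
  apply is_C_derive_plus; apply is_C_derive_mult;
    [exact Da|exact D1|exact Db|exact DR0].
- eexists; apply is_C_derive_scal.
  apply is_C_derive_plus; apply is_C_derive_mult;
    [exact Da|exact D1'|exact Db|exact DR1].
- eexists; exact Db.
- intros Hw1.
  destruct (excluded_middle_informative (a w = 1)) as [E|E].
  + rewrite (E_embed_w_to_E_infinity tau (exist _ w Hw1) Ht)
      by (exists m0; exact E).
    apply has_coords_scale with (two_pi_i ^ 3 * 2); unfold b; rewrite ?E; try ring.
    apply Cmult_neq_0; [apply Cpow_nz, two_pi_i_neq_0|apply RtoC_2_neq_0].
  + assert (E1 : 1 - a w <> 0).
    { intros E1; apply E; replace (a w) with (1 - (1 - a w)) by ring.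
      rewrite E1; ring. }
    assert (Hp : ~ is_calW_pole w q).
    { intros [m Hm]; destruct (Z.eq_dec m m0) as [->|Hmm]; [exact (E Hm)|].
      apply (Havw m Hmm); rewrite Hm; ring. }
    rewrite (E_embed_w_to_E_affine tau (exist _ w Hw1) Ht Hp); simpl proj1_sig.
    fold q.
    rewrite (calW_eq q m0), (calD_eq q m0) by assumption.
    fold c; fold (a w); fold (R0 w); fold (R1 w).
    apply has_coords_scale with (b w).
    * unfold b; repeat apply Cmult_neq_0; exact E1.
    * unfold b, koebe; field; exact E1.
    * unfold b, theta_koebe; field; exact E1.
    * ring.
Qed.

Theorem theorem7p1 (tau : C) (Htau : (0 < Im tau)%R) :
  let q := Cexp (two_pi_i * tau) in
  exists Phi : Cstar -> E tau,
    holomorphic_P2 (fun w : Cstar => E_embed tau (Phi w)) /\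
    (forall w : Cstar, ~ is_calW_pole (proj1_sig w) q ->
      E_embed tau (Phi w) =
      affine_pt
        (two_pi_i ^ 2 * calW (proj1_sig w) q - PI ^ 2 / 3 * E2 tau)
        (two_pi_i ^ 3 *
          (proj1_sig w * C_derive (fun v : C => calW v q) (proj1_sig w)))) /\
    (forall x : C, Phi (exp_star (tau * x)) = E_proj tau (exp_star x)).
Proof.
intros q; exists (w_to_E tau); split; [|split].
- apply w_to_E_holomorphic, Htau.
- intros [w Hw] Hp; simpl proj1_sig in *.
  assert (HD : C_derive (fun v : C => calW v q) w = / w * calD w q).
  { apply is_C_derive_unique, is_C_derive_calW; [apply Cexp_neq_0| |exact Hw|exact Hp].
    apply Cmod_nome_lt_1, Htau. }
  rewrite HD.
  rewrite (E_embed_w_to_E_affine tau (exist _ w Hw) Htau Hp); simpl proj1_sig.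
  fold q; do 2 f_equal; field; exact Hw.
- intros x; apply w_to_E_exp_star, upper_half_plane_neq_0, Htau.
Qed.
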